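(* Let $m$ be a nonnegative integer and $\lambda\in(-1/2,1)$ with $\lambda\ne0$. Then for all $x\in(-1,1)$ $$\frac{T_m(x)}{(1-x^2)^{\lambda}}=\frac{\sqrt{\pi}\,\Gamma(\lambda)}{\Gamma(\lambda+1/2)}\sum_{n=0}^\infty(\lambda+m+2n)\,\frac{\left\langle{\lambda\atop n}\right\rangle\left\langle{\lambda\atop m+n}\right\rangle}{\left\langle{2\lambda\atop m+2n}\right\rangle}\,C_{m+2n}^{(\lambda)}(x).$$ Moreover, the convergence of the series is uniform with respect to $x$ on every compact set contained in $(-1,1)$.
   Context: For a complex number $a$ and a nonnegative integer $n$, the rising factorial is $(a)_n=\prod_{0\le j<n}(a+j)$ (so $(a)_0=1$), and $\left\langle{a\atop n}\right\rangle=\frac{(a)_n}{n!}=(-1)^n\binom{-a}{n}$. $\Gamma$ is the Gamma function. The Gegenbauer polynomials $C_n^{(\lambda)}$, for real $\lambda>-1/2$, $\lambda\neq0$, are defined by the generating function $\frac{1}{(1-2xz+z^2)^{\lambda}}=\sum_{n=0}^\infty C_n^{(\lambda)}(x)z^n$ for $|z|<1$. $T_m$ is the Chebyshev polynomial of the first kind, defined by $T_m(\cos\theta)=\cos(m\theta)$ for $\theta\in\mathbb{R}$. *)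

(* Defs.v *)
From HB Require Import structures.
From mathcomp Require Import all_boot all_order all_algebra.
From mathcomp Require Import all_classical all_reals all_analysis.

Set Implicit Arguments.
Unset Strict Implicit.
Unset Printing Implicit Defensive.

Import Order.TTheory GRing.Theory Num.Theory.
Import numFieldNormedType.Exports.

Local Open Scope classical_set_scope.
Local Open Scope ring_scope.

Definition rising_factorial (F : fieldType) (a : F) (n : nat) : F :=
  \prod_(j < n) (a + j%:R).

(* the bracket <a over n> = (a)_n / n! *)
Definition rising_binomial (F : fieldType) (a : F) (n : nat) : F :=
  rising_factorial a n / n`!%:R.

Definition Euler_integral (R : realType) (x : R) : R :=
  \int[lebesgue_measure]_(t in `]0, +oo[) (t `^ (x - 1) * expR (- t)).

(* For x <= 0 the integral diverges; Gamma is continued by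
   Gamma x = Gamma (x + k) / (x)_k, where k is the least natural number with
   0 < x + k.  At the poles x = 0, -1, -2, ... the value is the junk 0. *)
Definition Gamma (R : realType) (x : R) : R :=
  if 0 < x then Euler_integral x
  else let k := (Num.truncn (- x)).+1 in
       Euler_integral (x + k%:R) / rising_factorial x k.

(* the polynomial T_m such that T_m(cos theta) = cos (m theta) for all theta *)
Definition chebyshevT (R : realType) (m : nat) : {poly R} :=
  xget 0 [set T : {poly R} |
    forall theta : R, T.[cos theta] = cos (m%:R * theta)].

(* The family of polynomials with the generating function
   1 / (1 - 2 x z + z^2) ^ lambda for |z| < 1.  The argument x ranges over
   [-1, 1], where 1 - 2 x z + z^2 > 0 whenever z is real and |z| < 1; this
   determines every polynomial of the family. *)
Definition gegenbauer (R : realType) (lambda : R) : nat -> {poly R} :=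
  xget (fun=> 0) [set C : nat -> {poly R} |
    forall x z : R, -1 <= x <= 1 -> `|z| < 1 ->
      series (fun n => (C n).[x] * z ^+ n) @ \oo
        --> ((1 - 2 * x * z + z ^+ 2) `^ lambda)^-1].

(* Main.v *)
(* Write <a, n> for the bracket, g_n = <l, n>, C_n = g_n u_n, and
   v_k = (l + k) C_k / <2l, k>, so that the series is
   S_m = \sum_n g_n g_(m+n) v_(m+2n).  The three-term recurrence of the
   Gegenbauer polynomials gives, for the partial sums and up to boundary terms,
   2 x S_(m+1) = S_(m+2) + S_m and x S_0 = S_1, which is the Chebyshev
   recurrence in m; everything thus reduces to m = 0.  There
   (1 - x^2) S_0 = const + 2 (l - 1) G with G' = S_1 = x S_0, hence the derivative
   of (1 - x^2)^l S_0 is a boundary term.  The boundary terms vanish locally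
   uniformly because an energy argument bounds u_n and because g_n -> 0 while
   g_n v_(2n) stays bounded.  So S_m = sigma T_m / (1 - x^2)^l with sigma
   independent of m; letting m -> oo along even integers in the alternating
   series S_m(0) turns sigma into a limit of brackets, times the alternating
   series of the g_n, whose sum is 2^-l. *)

Require Import Defs.
From HB Require Import structures.
From mathcomp Require Import all_boot all_order all_algebra.
From mathcomp Require Import all_classical all_reals all_analysis.
From mathcomp Require Import measurable_realfun gauss_integral ring lra.

Set Implicit Arguments.
Unset Strict Implicit.
Unset Printing Implicit Defensive.

Import Order.TTheory GRing.Theory Num.Theory.
Import numFieldNormedType.Exports.

Local Open Scope classical_set_scope.
Local Open Scope ring_scope.

(** * The bracket <a, n> *)

(** The available bounds make the terms of the series [O(n^(l-1))], which is not summable for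
    [0 < l < 1]. So nothing is done termwise to the infinite series: every relation among the [S_m]
    is an exact identity between partial sums with an explicit boundary term, proved by induction on
    the number of terms, and limits are taken only afterwards.

    The Gegenbauer family and [T_m] are chosen by a specification, so polynomials satisfying it have
    to be constructed first. For the Gegenbauer family this requires the generating series to
    converge for all [|z| < 1] even at [x = 1] and [x = -1], where no bound uniform in [n] is at
    hand; this is why the energy carries a second parameter.

    Gamma is an integral, and the properties used are derived from it: the recurrence, the value at
    1/2, and the limit [1 / Gamma c] of [<c, n> n^(1-c)] for [c] equal to [l], [1/2] and
    [l + 1/2]. *)

Section rising_binomial_theory.
Context {F : numFieldType}.
Implicit Types (a : F) (n : nat).

Lemma rising_factorialS a n :
  rising_factorial a n.+1 = rising_factorial a n * (a + n%:R).
Proof. by rewrite /rising_factorial big_ord_recr. Qed.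

Lemma rising_factorialSl a n :
  rising_factorial a n.+1 = a * rising_factorial (a + 1) n.
Proof.
rewrite /rising_factorial big_ord_recl addr0; congr (_ * _).
by apply: eq_bigr => i _ /=; rewrite /bump /= -addrA nat1r.
Qed.

Lemma rising_binomial0 a : rising_binomial a 0 = 1.
Proof. by rewrite /rising_binomial /rising_factorial big_ord0 fact0 divr1. Qed.

Lemma rising_binomialS a n :
  rising_binomial a n.+1 = rising_binomial a n * ((a + n%:R) / n.+1%:R).
Proof.
by rewrite /rising_binomial rising_factorialS factS natrM invfM mulrACA mulrA
  [RHS]mulrAC !mulrA; congr (_ * _); rewrite mulrAC.
Qed.

Lemma rising_binomial1 a : rising_binomial a 1 = a.
Proof. by rewrite rising_binomialS rising_binomial0 mul1r addr0 divr1. Qed.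

Lemma rising_binomial_neq0 a n :
  (forall k : nat, a + k%:R != 0) -> rising_binomial a n != 0.
Proof.
move=> a0; elim: n => [|n ih]; first by rewrite rising_binomial0 oner_eq0.
by rewrite rising_binomialS mulf_neq0// mulf_neq0// invr_neq0// pnatr_eq0.
Qed.

Lemma rising_binomial_shift a n : a != 0 ->
  rising_binomial (a + 1) n = rising_binomial a n * (a + n%:R) / a.
Proof.
move=> a0; rewrite /rising_binomial; apply: (mulfI a0).
by rewrite mulrA -rising_factorialSl rising_factorialS [RHS]mulrC divfK// mulrAC.
Qed.

(** The [4^n] of [(2a)_(2n) = 4^n (a)_n (a+1/2)_n] cancels against the one of
    [(2n)! = 4^n (1/2)_n n!]. This is how the parameters [1/2] and [l + 1/2], hence [sqrt pi] and
    [Gamma (l + 1/2)], enter the constant. *)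
Lemma rising_binomial_double a n :
  rising_binomial (2 * a) (n + n) * rising_binomial 2^-1 n =
  rising_binomial a n * rising_binomial (a + 2^-1) n.
Proof.
elim: n => [|n ih]; first by rewrite addn0 !rising_binomial0.
rewrite addnS addSn !(rising_binomialS _ n).
rewrite (rising_binomialS _ (n + n).+1).
rewrite (rising_binomialS _ (n + n)) [RHS]mulrACA -ih.
field.
by rewrite -!natrD !nat1r !pnatr_eq0.
Qed.

End rising_binomial_theory.

(** * Recurrences for Gegenbauer polynomials and partial sums *)

Section gegenbauer_recurrence.
Context {R : realType} (l : R).
Hypotheses (l_gt : - 2^-1 < l) (l_neq0 : l != 0).

Let addln_neq0 (n : nat) : l + n%:R != 0.
Proof.
case: n => [|n]; first by rewrite addr0.
by apply: lt0r_neq0; rewrite -natr1; have ? := ler0n R n; have ? := l_gt; lra.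
Qed.

Let add2ln_neq0 (n : nat) : 2 * l + n%:R != 0.
Proof.
case: n => [|n]; first by rewrite addr0 mulf_neq0.
by apply: lt0r_neq0; rewrite -natr1; have ? := ler0n R n; have ? := l_gt; lra.
Qed.

Local Ltac neq0 k :=
  let H1 := fresh in let H2 := fresh in
  have := ler0n R k; have := addln_neq0 k; have := add2ln_neq0 k;
  have := l_gt; have := l_neq0; rewrite ?natrD ?natrM;
  move=> ? ? H2 H1 ?; repeat (apply/andP; split);
  first [ by apply: lt0r_neq0; lra
        | by rewrite pnatr_eq0
        | by apply: contra_neq H1 => ?; lra
        | by apply: contra_neq H2 => ?; lra ].

(* geg_u n is the Gegenbauer polynomial of degree n divided by <l, n>; this
   normalization brings its recurrence within O(1/n^2) of that of the Chebyshev
   polynomials of the second kind. *)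
Definition geg_q (k : nat) : R :=
  k.+1%:R * (k%:R + 2 * l) / ((k.+1%:R + l) * (k%:R + l)).

Fixpoint geg_u (n : nat) : {poly R} :=
  if n is n1.+1 then
    if n1 is n2.+1 then (2 * 'X) * geg_u n1 - (geg_q n2)%:P * geg_u n2
    else 2 * 'X
  else 1.

(* In these terms the n-th term of the series in the theorem is
   <l, n> <l, m + n> geg_v (m + 2 n). *)
Definition geg_e (k : nat) : R :=
  (l + k%:R) * rising_binomial l k / rising_binomial (2 * l) k.

Definition geg_v (k : nat) (x : R) : R := geg_e k * (geg_u k).[x].

Definition geg_sum (m N : nat) (x : R) : R :=
  \sum_(0 <= n < N)
    rising_binomial l n * rising_binomial l (m + n) * geg_v (m + 2 * n) x.

Lemma horner_geg_u0 x : (geg_u 0).[x] = 1.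
Proof. by rewrite hornerC. Qed.

Lemma horner_geg_u1 x : (geg_u 1).[x] = 2 * x.
Proof. by rewrite /= -[2]/(2%:R) -polyC_natr hornerCM hornerX. Qed.

Lemma horner_geg_uSS n x :
  (geg_u n.+2).[x] = 2 * x * (geg_u n.+1).[x] - geg_q n * (geg_u n).[x].
Proof.
have -> : geg_u n.+2 = (2 * 'X) * geg_u n.+1 - (geg_q n)%:P * geg_u n by [].
by rewrite hornerD hornerN hornerM hornerCM -(horner_geg_u1 x).
Qed.

Lemma geg_eS k : geg_e k.+1 = geg_e k * ((l + k.+1%:R) / (2 * l + k%:R)).
Proof.
rewrite /geg_e !rising_binomialS.
have h := rising_binomial_neq0 k add2ln_neq0.
field.
by rewrite h/=; neq0 k.
Qed.

Lemma geg_e0 : geg_e 0 = l.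
Proof. by rewrite /geg_e !rising_binomial0 addr0 divr1 mulr1. Qed.

Lemma geg_v1 x : geg_v 1 x = (l + 1) / l * x * geg_v 0 x.
Proof.
rewrite /geg_v geg_eS geg_e0 horner_geg_u0 horner_geg_u1.
by field; neq0 0%N.
Qed.

Lemma geg_vSS k x : geg_v k.+2 x = (l + k.+2%:R) / (2 * l + k.+1%:R)
  * (2 * x * geg_v k.+1 x - k.+1%:R / (l + k%:R) * geg_v k x).
Proof.
rewrite /geg_v !geg_eS horner_geg_uSS /geg_q.
by field; neq0 k.
Qed.

Lemma geg_sumS m N x : geg_sum m N.+1 x = geg_sum m N x +
  rising_binomial l N * rising_binomial l (m + N) * geg_v (m + 2 * N) x.
Proof. by rewrite /geg_sum big_nat_recr. Qed.

Lemma geg_sum_0 m x : geg_sum m 0 x = 0.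
Proof. by rewrite /geg_sum big_geq. Qed.

(** Formally the case [m = -1] of [geg_sum_rec]: a shift of the summation index identifies [S_(-1)]
    with [S_1], just as [T_(-1) = T_1]. *)
Lemma geg_sum_rec0 N x : 2 * geg_sum 1 N.+1 x = 2 * x * geg_sum 0 N.+1 x
  + rising_binomial l N.+1 ^+ 2 * ((2 * N).+2%:R / (l + (2 * N).+1%:R))
    * geg_v (2 * N).+1 x.
Proof.
elim: N => [|N ih].
  rewrite !geg_sumS !geg_sum_0 !rising_binomialS !rising_binomial0.
  rewrite muln0 addn0 geg_v1.
  by field; neq0 0%N.
rewrite !(geg_sumS _ N.+1) !mulrDr {}ih !add1n !add0n.
rewrite (_ : (2 * N.+1)%N = (2 * N).+2) ?mulnS// geg_vSS.
rewrite !(rising_binomialS _ N.+1) !(rising_binomialS _ N).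
by field; neq0 (2 * N)%N.
Qed.

(** Expand each [2 x v_(k+1)] by [geg_vSS]. The coefficients of all [v_(m+2n)] with [n < N] cancel;
    that of [v_(m+2N)] survives because [S_m] stops one step before the two other sums. *)
Lemma geg_sum_rec m N x :
  geg_sum m.+2 N x + geg_sum m N x = 2 * x * geg_sum m.+1 N x
  + (rising_binomial l N * rising_binomial l (m + N)) * (
    ((l + (m + N)%:R) * (m.+1 + 2 * N)%:R
      / ((m.+1 + N)%:R * (l + (m + 2 * N)%:R))) - 1) * geg_v (m + 2 * N) x.
Proof.
elim: N => [|N ih].
  rewrite !geg_sum_0 muln0 addn0 !addr0 mulr0 add0r (_ : _ - 1 = 0).
    by rewrite mulr0 mul0r.
  by field; neq0 m.
rewrite !geg_sumS (mulrDr (2 * x)) addrACA {}ih (_ : (2 * N.+1)%N = (2 * N).+2) ?mulnS//.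
rewrite !addnS !addSn geg_vSS.
rewrite !rising_binomialS.
by field; have ? := ler0n R m; have ? := ler0n R N; neq0 (m + 2 * N)%N.
Qed.

(** * Derivatives of Gegenbauer polynomials and an antiderivative of [S_1] *)

Lemma derivCM (c : R) (p : {poly R}) : (c%:P * p)^`() = c%:P * p^`().
Proof. by rewrite !mul_polyC derivZ. Qed.

(** The Gegenbauer polynomial itself; [gegenbauerE] makes the identification once the generating
    function is known. *)
Definition geg_c (n : nat) : {poly R} := (rising_binomial l n)%:P * geg_u n.

Lemma horner_geg_c n x : (geg_c n).[x] = rising_binomial l n * (geg_u n).[x].
Proof. by rewrite hornerCM. Qed.

Lemma geg_c0 : geg_c 0 = 1.
Proof. by rewrite /geg_c rising_binomial0 mulr1. Qed.

Lemma geg_c1 : geg_c 1 = (2 * l)%:P * 'X.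
Proof. by rewrite /geg_c rising_binomial1 /= polyCM polyC_natr mulrA (mulrC l%:P). Qed.

Lemma geg_cSS n : n.+2%:R%:P * geg_c n.+2 =
  (2 * (n.+1%:R + l))%:P * ('X * geg_c n.+1) - (n%:R + 2 * l)%:P * geg_c n.
Proof.
rewrite /geg_c !rising_binomialS.
have -> : geg_u n.+2 = (2 * 'X) * geg_u n.+1 - (geg_q n)%:P * geg_u n by [].
move: (geg_u n.+1) (geg_u n) (rising_binomial l n) => u1 u0 g.
rewrite mulrBr mulrBr; congr (_ - _).
  rewrite -[2]/(2%:R) -polyC_natr !mulrA -!rmorphM/= -!mulrA.
  rewrite (mulrCA 'X) !mulrA -!rmorphM/=; congr (_%:P * _ * _).
  by field; neq0 n.
rewrite !mulrA -!rmorphM/=; congr (_%:P * _).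
by rewrite /geg_q; field; neq0 n.
Qed.

Lemma deriv_geg_cSS n x : n.+2%:R * (geg_c n.+2)^`().[x] =
  2 * (n.+1%:R + l) * ((geg_c n.+1).[x] + x * (geg_c n.+1)^`().[x])
  - (n%:R + 2 * l) * (geg_c n)^`().[x].
Proof.
have := geg_cSS n; move: (geg_c _) (geg_c _) (geg_c _) => p2 p1 p0.
move/(congr1 (fun p => p^`().[x])).
by rewrite derivB !derivCM derivM derivX mul1r hornerD hornerN !hornerCM
  hornerD hornerM hornerX.
Qed.

Lemma horner_geg_cSS n x : n.+2%:R * (geg_c n.+2).[x] =
  2 * (n.+1%:R + l) * (x * (geg_c n.+1).[x]) - (n%:R + 2 * l) * (geg_c n).[x].
Proof.
have := geg_cSS n; move: (geg_c _) (geg_c _) (geg_c _) => p2 p1 p0.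
move/(congr1 (horner^~ x)).
by rewrite /= hornerD hornerN !hornerCM hornerM hornerX.
Qed.

(** The two classical relations need each other: the second one at [n + 1] follows from the first at
    [n] and the differentiated recurrence, and the first at [n + 1] uses both at [n] together with
    the new second one. *)
Lemma deriv_geg_c n x :
  x * (geg_c n.+1)^`().[x] - (geg_c n)^`().[x] = n.+1%:R * (geg_c n.+1).[x] /\
  (geg_c n.+1)^`().[x] - x * (geg_c n)^`().[x] = (n%:R + 2 * l) * (geg_c n).[x].
Proof.
elim: n => [|n [P Q]].
  by rewrite geg_c0 geg_c1 derivCM derivX derivC !hornerCM !hornerC hornerX; split; ring.
have Q1 : (geg_c n.+2)^`().[x] - x * (geg_c n.+1)^`().[x]
    = (n.+1%:R + 2 * l) * (geg_c n.+1).[x].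
  have n2 : n.+2%:R != 0 :> R by rewrite pnatr_eq0.
  apply: (mulfI n2); rewrite mulrBr deriv_geg_cSS.
  have := congr1 ( *%R (n%:R + 2 * l)) P.
  rewrite -!natr1; lra.
split => //.
rewrite horner_geg_cSS.
have := congr1 ( *%R x) P; have := congr1 ( *%R x) Q1.
rewrite -!natr1; lra.
Qed.

(** Subtracting the two relations of [deriv_geg_c] at consecutive indices gives
    [C'_(k+2) - C'_k = 2 (l + k + 1) C_(k+1)], from which this antiderivative of [geg_v k.+1] is
    read off. *)
Definition geg_V (k : nat) : {poly R} :=
  ((2 * rising_binomial (2 * l) k.+1)^-1)%:P * (geg_c k.+2 - geg_c k).

Lemma deriv_geg_V k x : (geg_V k)^`().[x] = geg_v k.+1 x.
Proof.
rewrite derivCM hornerCM derivB hornerD hornerN.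
have [_ Q] := deriv_geg_c k.+1 x; have [P _] := deriv_geg_c k x.
have -> : (geg_c k.+2)^`().[x] - (geg_c k)^`().[x] =
    2 * (l + k.+1%:R) * (geg_c k.+1).[x].
  by move: P Q; rewrite -!natr1; lra.
rewrite horner_geg_c /geg_v /geg_e.
have h := rising_binomial_neq0 k.+1 add2ln_neq0.
by field.
Qed.

Lemma horner_geg_V k x : (geg_V k).[x] = 2^-1 * (
  (2 * l + k.+1%:R) / (k.+2%:R * (l + k.+2%:R)) * geg_v k.+2 x
  - k.+1%:R / ((2 * l + k%:R) * (l + k%:R)) * geg_v k x).
Proof.
rewrite hornerCM hornerD hornerN !horner_geg_c /geg_v /geg_e.
rewrite !(rising_binomialS (2 * l)).
have h := rising_binomial_neq0 k add2ln_neq0.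
by field; rewrite h/=; neq0 k.
Qed.

Definition geg_G (N : nat) : {poly R} :=
  \sum_(0 <= n < N)
    (rising_binomial l n * rising_binomial l n.+1)%:P * geg_V (2 * n).

Lemma deriv_geg_G N x : (geg_G N)^`().[x] = geg_sum 1 N x.
Proof.
rewrite /geg_G linear_sum/= horner_sum; apply: eq_bigr => n _.
by rewrite derivCM hornerCM deriv_geg_V add1n.
Qed.

(** By the recurrences in [m] the left side is [2 (1 - x^2) S_0] up to boundary terms, so this
    expresses [(1 - x^2) S_0] through a function whose derivative is known. *)
Lemma geg_sum02 N x : geg_sum 0 N.+1 x - geg_sum 2 N.+1 x =
  2 * l - 1 + 4 * (l - 1) * (geg_G N.+1).[x]
  - rising_binomial l N * (rising_binomial l N.+2 + 2 * (l - 1)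
      * rising_binomial l N.+1 * (2 * l + (2 * N).+1%:R)
         / ((2 * N).+2%:R * (l + (2 * N).+2%:R))) * geg_v (2 * N).+2 x.
Proof.
have GS M : (geg_G M.+1).[x] = (geg_G M).[x] + rising_binomial l M *
    rising_binomial l M.+1 * (geg_V (2 * M)).[x].
  by rewrite /geg_G big_nat_recr//= hornerD hornerCM.
elim: N => [|N ih].
  rewrite GS !geg_sumS !geg_sum_0 /geg_G big_geq// hornerC horner_geg_V.
  rewrite muln0 !addn0 !rising_binomialS !rising_binomial0.
  have -> : geg_v 0 x = l by rewrite /geg_v geg_e0 horner_geg_u0 mulr1.
  by field; neq0 0%N.
rewrite GS !(geg_sumS _ N.+1) horner_geg_V opprD addrACA {}ih.
rewrite (_ : (2 * N.+1)%N = (2 * N).+2) ?mulnS// !add0n !add2n.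
rewrite !rising_binomialS.
by field; have ? := ler0n R N; neq0 (2 * N)%N.
Qed.

End gegenbauer_recurrence.

(** * Energy bounds *)

(* The energy is u^2 - 2 x u v + (1 + h^2) v^2.  With h = 0 it is coercive on
   compact subsets of ]-1, 1[ and preserved up to the perturbation e; h > 0
   restores coercivity on [-1, 1] at the price of a growth factor near 1. *)
Lemma energy_step (R : realType) (x h s e u v w : R) :
  -1 <= x <= 1 -> 0 <= h -> 0 < s -> s <= 1 - x ^+ 2 + h ^+ 2 -> `|e| <= 3 ->
  w = 2 * x * u - (1 + e) * v ->
  w ^+ 2 - 2 * x * w * u + (1 + h ^+ 2) * u ^+ 2 <=
  (u ^+ 2 - 2 * x * u * v + (1 + h ^+ 2) * v ^+ 2)
   * ((1 + h + h ^+ 2) * (1 + (1 + 4 / s) * `|e|)).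
Proof.
move=> /andP[x1 x2] h0 s0 sle e3 ->.
set F := u ^+ 2 - _ + _.
(* [F0] is the energy after the unperturbed step [w = 2 x u - v]. It equals [F] for [h = 0], and in
   general exceeds it by a factor of at most [1 + h + h^2]. *)
set F0 := F + h ^+ 2 * (u ^+ 2 - v ^+ 2).
have x21 : x ^+ 2 <= 1 by nra.
have FE : F = (u - x * v) ^+ 2 + (1 - x ^+ 2 + h ^+ 2) * v ^+ 2 by rewrite /F; ring.
have F0E : F0 = (x * u - v) ^+ 2 + (1 - x ^+ 2 + h ^+ 2) * u ^+ 2 by rewrite /F0 /F; ring.
have sF : s * v ^+ 2 <= F.
  have := sqr_ge0 (u - x * v); have := sqr_ge0 v; nra.
have hF : h ^+ 2 * v ^+ 2 <= F - (u - x * v) ^+ 2.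
  have := sqr_ge0 v; nra.
have Fge0 : 0 <= F by apply: le_trans sF; rewrite mulr_ge0 ?sqr_ge0// ltW.
have F0le : F0 <= F * (1 + h + h ^+ 2).
  (* With [y = u - x v], the left side contains the cross term [2 h^2 x y v], which is at most
     [h (y^2 + h^2 x^2 v^2)]. *)
  have key : h ^+ 2 * (u ^+ 2 - v ^+ 2) <= h ^+ 2 * (u - x * v) ^+ 2
      + h * ((u - x * v) ^+ 2 + h ^+ 2 * v ^+ 2).
    have h1 : 0 <= h * ((u - x * v) - h * x * v) ^+ 2 by rewrite mulr_ge0// sqr_ge0.
    have h2 : 0 <= h ^+ 2 * (1 - x ^+ 2) * v ^+ 2.
      by rewrite mulr_ge0 ?sqr_ge0// mulr_ge0 ?sqr_ge0// subr_ge0.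
    have h3 : 0 <= h * (h ^+ 2 * (1 - x ^+ 2) * v ^+ 2) by rewrite mulr_ge0.
    lra.
  have h4 : h * ((u - x * v) ^+ 2 + h ^+ 2 * v ^+ 2) <= h * F.
    by rewrite ler_wpM2l//; lra.
  have h5 : h ^+ 2 * (u - x * v) ^+ 2 <= h ^+ 2 * F.
    rewrite ler_wpM2l ?sqr_ge0//; have := sqr_ge0 v; have := sqr_ge0 h; nra.
  rewrite /F0; lra.
have -> : (2 * x * u - (1 + e) * v) ^+ 2 - 2 * x * (2 * x * u - (1 + e) * v) * u
    + (1 + h ^+ 2) * u ^+ 2 = F0 - 2 * e * v * (x * u - v) + e ^+ 2 * v ^+ 2.
  by rewrite /F0 /F; ring.
have vF : v ^+ 2 <= F / s by rewrite ler_pdivlMr// mulrC.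
have yF0 : (x * u - v) ^+ 2 <= F0.
  rewrite F0E lerDl mulr_ge0 ?sqr_ge0//; lra.
have t1 : - (2 * e * v * (x * u - v)) <= `|e| * (v ^+ 2 + (x * u - v) ^+ 2).
  have [e0|e0] := leP 0 e.
    by rewrite ger0_norm//; have := mulr_ge0 e0 (sqr_ge0 (v + (x * u - v))); lra.
  have e0' : 0 <= - e by lra.
  by rewrite ltr0_norm//; have := mulr_ge0 e0' (sqr_ge0 (v - (x * u - v))); lra.
have t2 : e ^+ 2 * v ^+ 2 <= 3 * `|e| * v ^+ 2.
  rewrite ler_wpM2r ?sqr_ge0// -real_normK ?num_real// expr2 ler_wpM2r//.
have t3 : `|e| * v ^+ 2 <= `|e| * (F / s) by rewrite ler_wpM2l.
have t4 : `|e| * (x * u - v) ^+ 2 <= `|e| * F0 by rewrite ler_wpM2l.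
have Fs0 : 0 <= F / s by rewrite divr_ge0// ltW.
have t5 : F0 * (1 + `|e|) <= F * (1 + h + h ^+ 2) * (1 + `|e|).
  by rewrite ler_wpM2r// addr_ge0.
have t6 : `|e| * (F / s) <= (1 + h + h ^+ 2) * (`|e| * (F / s)).
  apply: ler_peMl; first by rewrite mulr_ge0.
  by have := sqr_ge0 h; lra.
have -> : F * ((1 + h + h ^+ 2) * (1 + (1 + 4 / s) * `|e|)) =
   F * (1 + h + h ^+ 2) * (1 + `|e|) + 4 * ((1 + h + h ^+ 2) * (`|e| * (F / s))).
  ring.
lra.
Qed.

Section gegenbauer_bound.
Context {R : realType} (l : R).
Hypotheses (l_gt : - 2^-1 < l) (l_lt1 : l < 1) (l_neq0 : l != 0).

Let eps (k : nat) : R := geg_q l k - 1.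

Let epsE k : eps k = l * (1 - l) / ((k.+1%:R + l) * (k%:R + l)).
Proof.
have k0 := ler0n R k; rewrite /eps /geg_q -natr1.
have : k%:R + l != 0.
  case: k k0 => [|k] k0; first by rewrite add0r.
  by apply: lt0r_neq0; rewrite -natr1; move: l_gt (ler0n R k); lra.
move=> kl; field; rewrite kl/=.
by apply: lt0r_neq0; move: l_gt; lra.
Qed.

(** Here the denominator contains the factor [l], which may be small or negative; it cancels and
    leaves [(1 - l) / (1 + l)], which stays below 3 for [l > -1/2]. *)
Let eps0 : `|eps 0| <= 3.
Proof.
rewrite epsE add0r.
have -> : l * (1 - l) / ((1 + l) * l) = (1 - l) / (1 + l).
  by field; rewrite l_neq0 andbT; apply: lt0r_neq0; move: l_gt; lra.
rewrite ger0_norm ?divr_ge0 ?ler_pdivrMr; move: l_gt l_lt1; lra.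
Qed.

(** From [k = 1] on the terms telescope, as [1/((k+1+l)(k+l)) = 1/(k+l) - 1/(k+1+l)]. Since
    [1/(1+l) <= 2], the total is at most 6, the exponent in [geg_u_energy]. *)
Let sum_eps n : \sum_(k < n.+1) `|eps k| <=
  3 + 3 / 2 * ((1 + l)^-1 - (n.+1%:R + l)^-1).
Proof.
elim: n => [|n ih]; first by rewrite big_ord1 subrr mulr0 addr0.
rewrite big_ord_recr/=; apply: le_trans (lerD ih (lexx _)) _.
rewrite epsE.
have n0 := ler0n R n.
have p1 : 0 < n.+1%:R + l by rewrite -natr1; move: l_gt; lra.
have p2 : 0 < n.+2%:R + l by rewrite -!natr1; move: l_gt; lra.
have -> : l * (1 - l) / ((n.+2%:R + l) * (n.+1%:R + l)) =
   l * (1 - l) * ((n.+1%:R + l)^-1 - (n.+2%:R + l)^-1).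
  rewrite -[n.+2%:R]natr1; field.
  by apply/andP; split; apply: lt0r_neq0; move: p1 p2; rewrite -!natr1; lra.
set d := _^-1 - _^-1 in ih *.
have d0 : 0 <= (n.+1%:R + l)^-1 - (n.+2%:R + l)^-1.
  by rewrite subr_ge0 lef_pV2 ?posrE// lerD2r ler_nat.
rewrite normrM (ger0_norm d0).
have b : `|l * (1 - l)| <= 3 / 2.
  rewrite ler_norml; move: l_gt l_lt1 => ? ?; apply/andP; split; nra.
have := ler_wpM2r d0 b; rewrite /d; lra.
Qed.

Let sum_eps_le6 n : \sum_(k < n) `|eps k| <= 6.
Proof.
case: n => [|n]; first by rewrite big_ord0.
apply: le_trans (sum_eps n) _.
have n0 := ler0n R n.
have p1 : 0 < n.+1%:R + l by rewrite -natr1; move: l_gt; lra.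
have : (1 + l)^-1 <= 2.
  by rewrite invf_ple ?posrE; move: l_gt; lra.
have : 0 <= (n.+1%:R + l)^-1 by rewrite invr_ge0 ltW.
lra.
Qed.

Let eps_le3 k : `|eps k| <= 3.
Proof.
case: k => // k; rewrite epsE.
have k0 := ler0n R k.
have p1 : 1 / 2 <= k.+1%:R + l by rewrite -[k.+1%:R]natr1; move: l_gt; lra.
have p2 : 1 <= k.+2%:R + l by rewrite -!natr1; move: l_gt; lra.
have p3 : 1 / 2 <= (k.+2%:R + l) * (k.+1%:R + l) by nra.
rewrite normrM normfV [X in _ / X]ger0_norm; last by lra.
rewrite ler_pdivrMr; last by lra.
have b : `|l * (1 - l)| <= 3 / 2.
  rewrite ler_norml; move: l_gt l_lt1 => ? ?; apply/andP; split; nra.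
lra.
Qed.

(** The energy starts at [1 + h^2]. Each step multiplies it by [1 + h + h^2] and by
    [1 + (1 + 4/s) |eps k|]; the product of the latter factors is at most the exponential of their
    summed perturbations. *)
Lemma geg_u_energy (x h s : R) n :
  -1 <= x <= 1 -> 0 <= h -> 0 < s -> s <= 1 - x ^+ 2 + h ^+ 2 ->
  ((geg_u l n).[x]) ^+ 2 <=
  (1 + h ^+ 2) / s * expR (6 * (1 + 4 / s)) * (1 + h + h ^+ 2) ^+ n.
Proof.
move=> x1 h0 s0 sle.
pose F n := (geg_u l n.+1).[x] ^+ 2 - 2 * x * (geg_u l n.+1).[x] * (geg_u l n).[x]
  + (1 + h ^+ 2) * (geg_u l n).[x] ^+ 2.
have h20 := sqr_ge0 h.
have c0 : 0 <= 1 + 4 / s by rewrite addr_ge0 // divr_ge0// ltW.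
have Fle : F n <= (1 + h ^+ 2) * (1 + h + h ^+ 2) ^+ n *
    expR (\sum_(k < n) (1 + 4 / s) * `|eps k|).
  elim: n => [|n ih].
    rewrite /F horner_geg_u0 horner_geg_u1 big_ord0 expR0 expr0; lra.
  rewrite big_ord_recr/= expRD (exprSr _ n).
  have := @energy_step R x h s (eps n) (geg_u l n.+1).[x] (geg_u l n).[x]
    (geg_u l n.+2).[x] x1 h0 s0 sle (eps_le3 n).
  rewrite horner_geg_uSS /eps (addrC 1) subrK => /(_ erefl).
  rewrite -horner_geg_uSS -/(F n) -/(F n.+1) => /le_trans; apply.
  have -> : forall A B C D E : R, A * (B * C) * (D * E) = (A * B * D) * (C * E).
    by move=> *; ring.
  apply: le_trans (_ : (1 + h ^+ 2) * (1 + h + h ^+ 2) ^+ n *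
    expR (\sum_(k < n) (1 + 4 / s) * `|eps k|) *
    ((1 + h + h ^+ 2) * (1 + (1 + 4 / s) * `|geg_q l n - 1|)) <= _).
    rewrite ler_wpM2r// mulr_ge0//; first by lra.
    by rewrite addr_ge0// mulr_ge0.
  rewrite ler_wpM2l//.
    by rewrite !mulr_ge0 ?expR_ge0 ?exprn_ge0//; lra.
  by rewrite ler_wpM2l ?expR_ge1Dx//; lra.
have uF : s * (geg_u l n).[x] ^+ 2 <= F n.
  have -> : F n = ((geg_u l n.+1).[x] - x * (geg_u l n).[x]) ^+ 2
    + (1 - x ^+ 2 + h ^+ 2) * (geg_u l n).[x] ^+ 2 by rewrite /F; ring.
  have := sqr_ge0 ((geg_u l n.+1).[x] - x * (geg_u l n).[x]).
  have := sqr_ge0 (geg_u l n).[x]; nra.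
have : expR (\sum_(k < n) (1 + 4 / s) * `|eps k|) <= expR (6 * (1 + 4 / s)).
  by rewrite ler_expR -mulr_sumr mulrC ler_wpM2r.
move=> eE.
have -> : (1 + h ^+ 2) / s * expR (6 * (1 + 4 / s)) * (1 + h + h ^+ 2) ^+ n =
  ((1 + h ^+ 2) * (1 + h + h ^+ 2) ^+ n * expR (6 * (1 + 4 / s))) / s by ring.
rewrite ler_pdivlMr// mulrC; apply: le_trans uF _; apply: le_trans Fle _.
by rewrite ler_wpM2l// mulr_ge0 ?exprn_ge0//; lra.
Qed.

Lemma geg_u_locally_bounded (r : R) : 0 <= r < 1 ->
  exists2 B : R, 0 <= B & forall n x, `|x| <= r -> `|(geg_u l n).[x]| <= B.
Proof.
move=> /andP[r0 r1].
have s0 : 0 < 1 - r ^+ 2 by nra.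
pose B2 := (1 - r ^+ 2)^-1 * expR (6 * (1 + 4 / (1 - r ^+ 2))).
exists (Num.sqrt B2); first exact: sqrtr_ge0.
move=> n x xr; rewrite -sqrtr_sqr ler_wsqrtr//.
have x2 : x ^+ 2 <= r ^+ 2 by rewrite -[x ^+ 2]real_normK ?num_real// lerXn2r ?nnegrE.
have x1 : -1 <= x <= 1 by rewrite -ler_norml; lra.
have sle : 1 - r ^+ 2 <= 1 - x ^+ 2 + 0 ^+ 2 by rewrite expr0n/=; lra.
have := geg_u_energy n x1 (lexx 0) s0 sle.
by rewrite expr0n/= !addr0 expr1n mulr1 mul1r.
Qed.

Lemma geg_u_subexponential (x r : R) : -1 <= x <= 1 -> 0 < r < 1 ->
  exists2 B : R, 0 <= B & forall n, `|(geg_u l n).[x]| <= B * r^-1 ^+ n.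
Proof.
move=> x1 /andP[r0 r1].
(* Then [1 + h + h^2 <= (1 + h)^2 = r^-2], so the energy grows at most like [r^(-2n)], and [s = h^2]
   works up to the endpoints. *)
pose h := r^-1 - 1.
have h0 : 0 < h by rewrite subr_gt0 invf_gt1.
have s0 : 0 < h ^+ 2 by rewrite exprn_gt0.
pose B2 := (1 + h ^+ 2) / h ^+ 2 * expR (6 * (1 + 4 / h ^+ 2)).
exists (Num.sqrt B2); first exact: sqrtr_ge0.
move=> n; rewrite -(ler_pXn2r (_ : 0 < 2)%N)// ?nnegrE//; last first.
  by rewrite mulr_ge0 ?sqrtr_ge0// exprn_ge0// invr_ge0 ltW.
rewrite real_normK ?num_real// exprMn sqr_sqrtr; last first.
  by rewrite mulr_ge0 ?expR_ge0// divr_ge0 ?ltW// addr_gt0.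
have x21 : x ^+ 2 <= 1 by case/andP: x1 => ? ?; nra.
have sle : h ^+ 2 <= 1 - x ^+ 2 + h ^+ 2 by lra.
apply: le_trans (geg_u_energy n x1 (ltW h0) s0 sle) _.
rewrite ler_wpM2l//.
  by rewrite mulr_ge0 ?expR_ge0// divr_ge0 ?ltW// addr_gt0.
have -> : r^-1 = 1 + h by rewrite /h; ring.
rewrite exprAC lerXn2r ?nnegrE ?sqr_ge0//; last by nra.
have h2 := sqr_ge0 h; lra.
Qed.

Lemma rising_binomial_le1 n : `|rising_binomial l n| <= 1.
Proof.
elim: n => [|n ih]; first by rewrite rising_binomial0 normr1.
rewrite rising_binomialS normrM mulr_ile1// normrM normfV [X in _ / X]ger0_norm//.
rewrite ler_pdivrMr// mul1r ler_norml -natr1; have n0 := ler0n R n.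
by move: l_gt l_lt1; lra.
Qed.

End gegenbauer_bound.

(** * Generating function *)

Section derivative_bound.
Context {R : realType}.

Lemma norm_sub_le_derive (f df : R -> R) (r M : R) :
  (forall y : R, `|y| <= r -> is_derive y (1 : R) f (df y)) ->
  (forall y : R, `|y| <= r -> `|df y| <= M) ->
  forall x y, `|x| <= r -> `|y| <= r -> `|f x - f y| <= M * `|x - y|.
Proof.
move=> fd dfM x y xr yr.
wlog xy : x y xr yr / x <= y.
  move=> H; have [/H|/ltW yx] := leP x y; first exact.
  by rewrite distrC (distrC x); exact: H.
rewrite distrC (distrC x).
have sub z : z \in `[x, y] -> `|z| <= r.
  rewrite in_itv/= => /andP[xz zy]; move: xr yr; rewrite !ler_norml; lra.
have [z zxy| |z zxy ->] := @MVT_segment R f df x y xy.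
- by apply: fd; apply: sub; exact: subset_itv_oo_cc.
- apply: derivable_within_continuous => z zxy.
  by have [] := fd z (sub z zxy).
- by rewrite normrM ler_wpM2r// dfM// sub.
Qed.

(** The power [q^(a-1)] is factored out so that a differential equation for [f], exact or up to
    boundary terms, can be applied inside the remaining bracket. *)
Lemma is_derive_powR_mul (q f : R -> R) (a dq df y : R) : 0 < q y ->
  is_derive y (1 : R) q dq -> is_derive y (1 : R) f df ->
  is_derive y (1 : R) (fun z => q z `^ a * f z)
    (q y `^ (a - 1) * (a * dq * f y + q y * df)).
Proof.
move=> q0 qd fd.
have h1 : is_derive y (1 : R) ((fun z => z `^ a) \o q) (a * q y `^ (a - 1) * dq).
  by apply: is_derive1_comp => //; exact: is_derive1_powR.
have h2 : is_derive y (1 : R) (fun z => q z `^ a * f z) _ := is_deriveM h1 fd.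
apply: (is_derive_eq h2); rewrite /GRing.scale/=.
have -> : q y `^ a = q y * q y `^ (a - 1).
  by rewrite powRB ?(gt_eqF q0) ?implybT// (powRr1 (ltW q0)) mulrCA divff ?mulr1 ?gt_eqF.
ring.
Qed.

End derivative_bound.

(** * Real power series converging on the open unit interval *)

Section subexponential.
Context {R : realType}.
Implicit Types (c : nat -> R) (x z : R).

(** Equivalent to convergence of [pseries c] on [|z| < 1], in a form that passes easily to the
    derived series. *)
Definition subexponential c := forall r : R, 0 < r < 1 ->
  exists2 B : R, 0 <= B & forall n, `|c n| <= B * r^-1 ^+ n.

(** Use the bound for some [s] strictly between [r] and 1: by Bernoulli's inequality the new factor
    [n + 1] is at most a constant times [(s/r)^(n+1)]. *)
Lemma subexponential_diffs c : subexponential c -> subexponential (pseries_diffs c).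
Proof.
move=> cs r /andP[r0 r1].
pose s := (1 + r) / 2.
have s0 : 0 < s by rewrite /s; lra.
have s01 : 0 < s < 1 by rewrite s0 /s; lra.
have rs : r < s by rewrite /s; lra.
have [B B0 cB] := cs s s01.
pose d := s / r - 1.
have d0 : 0 < d by rewrite subr_gt0 ltr_pdivlMr// mul1r.
exists (B / (d * r)); first by rewrite divr_ge0// mulr_ge0// ltW.
move=> n; rewrite /pseries_diffs normrM normr_nat.
have bern : n.+1%:R * d <= (s / r) ^+ n.+1.
  have -> : s / r = 1 + d by rewrite /d; ring.
  elim: {cB} n => [|n ih]; first by rewrite expr1 mul1r; lra.
  rewrite exprS -[n.+2%:R]natr1.
  have := ler0n R n.+1; have : 1 <= (1 + d) ^+ n.+1 by rewrite exprn_ege1//; lra.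
  nra.
apply: le_trans (ler_wpM2l (ler0n _ _) (cB n.+1)) _.
have -> : B / (d * r) * r^-1 ^+ n = B * d^-1 * r^-1 ^+ n.+1.
  by rewrite invfM exprS; ring.
have -> : r^-1 ^+ n.+1 = (s / r) ^+ n.+1 * s^-1 ^+ n.+1.
  by rewrite -exprMn; congr (_ ^+ _); field; rewrite !gt_eqF.
rewrite mulrCA -(mulrA B) ler_wpM2l// mulrA ler_wpM2r//.
  by rewrite exprn_ge0// invr_ge0 ltW.
by rewrite [leRHS]mulrC ler_pdivlMr.
Qed.

Lemma subexponential_cvg c z : subexponential c -> `|z| < 1 ->
  cvgn (pseries c z).
Proof.
move=> cs z1; have z0 := normr_ge0 z.
pose r := (1 + `|z|) / 2.
have r01 : 0 < r < 1 by rewrite /r; lra.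
have [B B0 cB] := cs r r01; have /andP[r0 r1] := r01.
apply: normed_cvg; apply: (series_le_cvg (v_ := geometric B (`|z| / r))).
- by move=> n; exact: normr_ge0.
- by move=> n; rewrite /geometric/= mulr_ge0// exprn_ge0// divr_ge0// ltW.
- move=> n; rewrite /geometric/= normrM normrX exprMn mulrCA [leLHS]mulrC.
  by rewrite ler_wpM2l// exprn_ge0.
- apply: is_cvg_geometric_series.
  rewrite ger0_norm; last by rewrite divr_ge0// ltW.
  by rewrite ltr_pdivrMr// /r; lra.
Qed.

Lemma subexponential_is_derive c z : subexponential c -> `|z| < 1 ->
  is_derive z (1 : R) (fun z => limn (pseries c z))
    (limn (pseries (pseries_diffs c) z)).
Proof.
move=> cs z1; have z0 := normr_ge0 z.
pose K := (1 + `|z|) / 2.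
have K1 : `|K| < 1 by rewrite [`|K|]ger0_norm /K; lra.
have cs1 := subexponential_diffs cs; have cs2 := subexponential_diffs cs1.
apply: (pseries_snd_diffs (K := K)); try exact: subexponential_cvg.
by rewrite [ltRHS]ger0_norm /K; lra.
Qed.

Lemma cvg_subexponential c :
  (forall z, `|z| < 1 -> cvgn (pseries c z)) -> subexponential c.
Proof.
move=> cc r /andP[r0 r1].
have r1' : `|r| < 1 by rewrite gtr0_norm.
have [K [Kreal Kf]] := cvg_series_bounded (cc r r1').
exists `|K + 1| => // n.
rewrite exprVn ler_pdivlMr ?exprn_gt0// .
have := Kf (K + 1); rewrite ltrDl ltr01 => /(_ isT n I).
by rewrite /= normrM (ger0_norm (exprn_ge0 _ (ltW r0))) => /le_trans; apply; rewrite ler_norm.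
Qed.

(** The value at 0 gives [c 0], and the derived series vanishes too, which gives the rest by
    induction. Needed for the uniqueness of the Gegenbauer family. *)
Lemma pseries_eq0 c :
  (forall z, `|z| < 1 -> pseries c z @ \oo --> (0 : R)) -> forall n, c n = 0.
Proof.
move=> c0 n; elim: n c c0 => [|n ih] c c0.
  have : pseries c 0 @ \oo --> c 0%N.
    rewrite -cvg_shiftS; apply: cvg_near_cst; near=> n.
    rewrite /pseries /series/= big_nat_recl// expr0 mulr1 big1 ?addr0//.
    by move=> i _; rewrite expr0n/= mulr0.
  by move/(cvg_unique _) => /(_ (@norm_hausdorff _ _) _ (c0 0 _)); apply; rewrite normr0.
have cs : subexponential c.
  by apply: cvg_subexponential => z z1; apply/cvg_ex; exists 0; exact: c0.
have : pseries_diffs c n = 0.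
  apply: ih => z z1.
  have [_ zd] := subexponential_is_derive cs z1.
  have <- : limn (pseries (pseries_diffs c) z) = 0.
    rewrite -zd (near_eq_derive (g := cst 0)) ?derive_cst//.
    near=> y; rewrite /cst; apply/cvg_lim => //; apply: c0.
    near: y.
    by apply: (cvgr_norm_lt z).
  exact: subexponential_cvg (subexponential_diffs cs) z1.
by rewrite /pseries_diffs => /eqP; rewrite mulf_eq0 pnatr_eq0/= => /eqP.
Unshelve. all: by end_near. Qed.

End subexponential.

(** * The differential equation of the generating function *)

Section generating_function.
Context {R : realType} (l : R).
Hypotheses (l_gt : - 2^-1 < l) (l_lt1 : l < 1) (l_neq0 : l != 0).

Lemma subexponential_geg_c (x : R) : -1 <= x <= 1 ->
  subexponential (fun n => (geg_c l n).[x]).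
Proof.
move=> x1 r r01; have [B B0 uB] := geg_u_subexponential l_gt l_lt1 l_neq0 x1 r01.
exists B => // n; rewrite horner_geg_c normrM.
by apply: le_trans (uB n); rewrite ler_piMl// rising_binomial_le1.
Qed.

(** The equation [(1 - 2xz + z^2) f' = 2l (x - z) f], exact for partial sums: the truncation orders
    are staggered so that all products stop at [z^(N+1)]. *)
Lemma pseries_geg_c_rec (x z : R) N :
  let A := pseries (fun n => (geg_c l n).[x]) z in
  let B := pseries (pseries_diffs (fun n => (geg_c l n).[x])) z in
  B N.+2 - 2 * x * z * B N.+1 + z ^+ 2 * B N =
  2 * l * x * A N.+2 - 2 * l * z * A N.+1.
Proof.
move=> A B.
have AS n : A n.+1 = A n + (geg_c l n).[x] * z ^+ n.
  by rewrite /A /pseries /series/= big_nat_recr.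
have BS n : B n.+1 = B n + n.+1%:R * (geg_c l n.+1).[x] * z ^+ n.
  by rewrite /B /pseries /series/= big_nat_recr.
have A0 : A 0%N = 0 by rewrite /A /pseries /series/= big_geq.
have B0 : B 0%N = 0 by rewrite /B /pseries /series/= big_geq.
have c0 : (geg_c l 0).[x] = 1 by rewrite geg_c0 hornerC.
have c1 : (geg_c l 1).[x] = 2 * l * x by rewrite geg_c1 hornerCM hornerX.
elim: N => [|N ih].
  rewrite !AS !BS A0 B0 (horner_geg_cSS l_gt l_neq0) c0 c1; ring.
move: ih; rewrite (BS N.+2) (BS N.+1) (BS N) (AS N.+2) (AS N.+1).
have -> : (geg_c l N.+3).[x] = (2 * (N.+2%:R + l) * (x * (geg_c l N.+2).[x])
    - (N.+1%:R + 2 * l) * (geg_c l N.+1).[x]) / N.+3%:R.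
  by rewrite -(horner_geg_cSS l_gt l_neq0) mulrC mulKf// pnatr_eq0.
rewrite [N.+3%:R * _]mulrC divfK ?pnatr_eq0// !exprS -!natr1.
lra.
Qed.

Lemma geg_generating_function (x z : R) : -1 <= x <= 1 -> `|z| < 1 ->
  pseries (fun n => (geg_c l n).[x]) z @ \oo -->
    ((1 - 2 * x * z + z ^+ 2) `^ l)^-1.
Proof.
move=> x1 z1.
pose c n := (geg_c l n).[x].
have cs : subexponential c by exact: subexponential_geg_c.
have csd := subexponential_diffs cs.
pose f z := limn (pseries c z).
pose df z := limn (pseries (pseries_diffs c) z).
pose q (z : R) := 1 - 2 * x * z + z ^+ 2.
have q0 y : `|y| < 1 -> 0 < q y.
  rewrite ltr_norml => /andP[y0 y1].
  have -> : q y = (1 + x) / 2 * (1 - y) ^+ 2 + (1 - x) / 2 * (1 + y) ^+ 2.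
    by rewrite /q; field.
  have p1 : 0 < (1 - y) ^+ 2 by rewrite exprn_gt0//; lra.
  have p2 : 0 < (1 + y) ^+ 2 by rewrite exprn_gt0//; lra.
  case/andP: x1 => x1 x2.
  have h1 : 0 <= (1 + x) * (1 - y) ^+ 2 by rewrite mulr_ge0 ?(ltW p1)//; lra.
  have h2 : 0 <= (1 - x) * (1 + y) ^+ 2 by rewrite mulr_ge0 ?(ltW p2)//; lra.
  have [x0|x0] := leP x 0.
    have : 0 < (1 - x) * (1 + y) ^+ 2 by rewrite mulr_gt0//; lra.
    lra.
  have : 0 < (1 + x) * (1 - y) ^+ 2 by rewrite mulr_gt0//; lra.
  lra.
have ode y : `|y| < 1 -> q y * df y = 2 * l * (x - y) * f y.
  move=> y1.
  have cA := subexponential_cvg cs y1; have cB := subexponential_cvg csd y1.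
  have cA1 : pseries c y n.+1 @[n --> \oo] --> f y by rewrite cvg_shiftS.
  have cB1 : pseries (pseries_diffs c) y n.+1 @[n --> \oo] --> df y.
    by rewrite cvg_shiftS.
  have cA2 : pseries c y n.+2 @[n --> \oo] --> f y.
    by rewrite (cvg_shiftS (fun n => pseries c y n.+1)).
  have cB2 : pseries (pseries_diffs c) y n.+2 @[n --> \oo] --> df y.
    by rewrite (cvg_shiftS (fun n => pseries (pseries_diffs c) y n.+1)).
  have L : (pseries (pseries_diffs c) y n.+2 - 2 * x * y *
     pseries (pseries_diffs c) y n.+1 + y ^+ 2 * pseries (pseries_diffs c) y n)
     @[n --> \oo] --> df y - 2 * x * y * df y + y ^+ 2 * df y.
    by apply: cvgD; [apply: cvgB => //; exact: cvgMr|exact: cvgMr].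
  have L' : (2 * l * x * pseries c y n.+2 - 2 * l * y * pseries c y n.+1)
     @[n --> \oo] --> 2 * l * x * f y - 2 * l * y * f y.
    by apply: cvgB; exact: cvgMr.
  have E : df y - 2 * x * y * df y + y ^+ 2 * df y = 2 * l * x * f y - 2 * l * y * f y.
    apply: (cvg_unique _ L) => //.
    rewrite (_ : (fun n => _) =
      (fun n => 2 * l * x * pseries c y n.+2 - 2 * l * y * pseries c y n.+1)) //.
    by apply/funext => n; exact: pseries_geg_c_rec.
  rewrite /q; move: E; lra.
have qd y : is_derive y (1 : R) q (2 * y - 2 * x).
  apply: trigger_derive; rewrite /GRing.scale/=; ring.
(* By the differential equation [q^l f] has derivative 0, so the mean value bound applies with
   constant 0. *)
have cst0 : q z `^ l * f z = q 0 `^ l * f 0.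
  apply/eqP; rewrite -subr_eq0 -normr_le0.
  have := @norm_sub_le_derive R (fun y => q y `^ l * f y) (fun=> 0) `|z| 0 _ _ z 0.
  rewrite mul0r normr0; apply => //= y yz.
  have y1 : `|y| < 1 by exact: le_lt_trans yz z1.
  have := is_derive_powR_mul l (q0 y y1) (qd y) (subexponential_is_derive cs y1).
  move=> H; apply: (is_derive_eq H).
  by rewrite -/(df y) -/(f y) ode//; ring.
have f0 : f 0 = 1.
  apply/cvg_lim => //; rewrite -cvg_shiftS; apply: cvg_near_cst; near=> n.
  rewrite /pseries /series/= big_nat_recl// expr0 mulr1 big1 ?addr0.
    by rewrite /c geg_c0 hornerC.
  by move=> i _; rewrite expr0n/= mulr0.
have : f z = (q z `^ l)^-1.
  apply: (mulfI (_ : q z `^ l != 0)); first by rewrite gt_eqF// powR_gt0// q0.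
  rewrite cst0 f0 divff ?gt_eqF ?powR_gt0 ?q0//.
  by rewrite /q mulr0 subr0 expr0n addr0 powR1 mulr1.
by rewrite -/(q z) => <-; exact: subexponential_cvg.
Unshelve. all: by end_near. Qed.

End generating_function.

(** * The polynomials of the statement *)

(** The family [geg_c] witnesses the specification, so the chosen family satisfies it as well; for
    each fixed [x] both are then coefficient sequences of the same power series in [z]. *)
Lemma gegenbauerE (R : realType) (l : R) (n : nat) (x : R) :
  - 2^-1 < l -> l < 1 -> l != 0 -> -1 <= x <= 1 ->
  (gegenbauer l n).[x] = (geg_c l n).[x].
Proof.
move=> l_gt l_lt1 l_neq0 x1.
have gP : forall x z : R, -1 <= x <= 1 -> `|z| < 1 ->
    series (fun n => (gegenbauer l n).[x] * z ^+ n) @ \oo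
      --> ((1 - 2 * x * z + z ^+ 2) `^ l)^-1.
  rewrite /gegenbauer.
  set P := [set C : nat -> {poly R} | _].
  apply: (@xgetPex _ _ P); exists (geg_c l) => y z y1 z1.
  exact: geg_generating_function.
apply/eqP; rewrite -subr_eq0; apply/eqP.
apply: (@pseries_eq0 R (fun n => (gegenbauer l n).[x] - (geg_c l n).[x])) => z z1.
rewrite (_ : pseries _ z = series (fun n => (gegenbauer l n).[x] * z ^+ n)
    - series (fun n => (geg_c l n).[x] * z ^+ n)).
  rewrite -(subrr (((1 - 2 * x * z + z ^+ 2) `^ l)^-1)).
  exact: cvgB (gP x z x1 z1) (geg_generating_function l_gt l_lt1 l_neq0 x1 z1).
apply/funext => N.
rewrite /pseries /series /= fctE -sumrB; apply: eq_bigr => i _.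
by rewrite mulrBl.
Qed.

Lemma chebyshevT_cos (R : realType) (m : nat) (theta : R) :
  (chebyshevT R m).[cos theta] = cos (m%:R * theta).
Proof.
rewrite /chebyshevT; set P := [set T : {poly R} | _].
suff /(@xgetPex _ 0 P) : exists T, P T by apply.
rewrite /P/= => {theta}.
suff [T [T' [TP T'P]]] : exists T T' : {poly R},
    (forall theta : R, T.[cos theta] = cos (m%:R * theta)) /\
    (forall theta : R, T'.[cos theta] = cos (m.+1%:R * theta)) by exists T.
elim: m {P} => [|m [T [T' [TP T'P]]]].
  exists 1, 'X; split=> theta; first by rewrite mul0r cos0 hornerC.
  by rewrite mul1r hornerX.
exists T', ((2 * 'X) * T' - T); split=> // theta.
(* [geg_u l 1] is [2 * 'X] for every [l]; the parameter 0 is arbitrary. *)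
rewrite hornerD hornerN hornerM (horner_geg_u1 0) TP T'P.
have -> : m.+2%:R * theta = m.+1%:R * theta + theta by rewrite -[m.+2%:R]natr1; ring.
have -> : m%:R * theta = m.+1%:R * theta - theta by rewrite -natr1; ring.
rewrite cosB cosD; ring.
Qed.

(** * The three-term recurrence of the Chebyshev polynomials *)

Section chebyshev_recurrence.
Context {R : realType}.
Implicit Types (x : R) (m : nat).

Lemma horner_chebyshevT0 x : -1 <= x <= 1 -> (chebyshevT R 0).[x] = 1.
Proof. by move=> x1; rewrite -(acosK x1) chebyshevT_cos mul0r cos0. Qed.

Lemma horner_chebyshevT1 x : -1 <= x <= 1 -> (chebyshevT R 1).[x] = x.
Proof. by move=> x1; rewrite -{1}(acosK x1) chebyshevT_cos mul1r acosK. Qed.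

Lemma horner_chebyshevTSS m x : -1 <= x <= 1 -> (chebyshevT R m.+2).[x] =
  2 * x * (chebyshevT R m.+1).[x] - (chebyshevT R m).[x].
Proof.
move=> x1; rewrite -[in LHS](acosK x1) -[in X in _ * _ * X](acosK x1).
rewrite -[in X in _ - X](acosK x1) !chebyshevT_cos.
have -> : m.+2%:R * acos x = m.+1%:R * acos x + acos x by rewrite -[m.+2%:R]natr1; ring.
have -> : m%:R * acos x = m.+1%:R * acos x - acos x by rewrite -natr1; ring.
rewrite cosB cosD acosK//; ring.
Qed.

End chebyshev_recurrence.

(** * The Gamma function *)

Section Euler_integral_theory.
Context {R : realType}.
Implicit Types (x a s t : R).
Local Notation mu := (@lebesgue_measure R).

(** Monotone convergence along segments exhausting the half-line; integration by parts and
    substitution can then be carried out away from the singularity at 0. *)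
Lemma ge0_cvg_integral_0y (f : R -> R) (a b : nat -> R) :
  (forall n, 0 < a n) -> {homo a : n m / (n <= m)%N >-> m <= n} ->
  {homo b : n m / (n <= m)%N >-> n <= m} ->
  a @ \oo --> 0 -> b @ \oo --> +oo ->
  (forall x, 0 < x -> 0 <= f x) -> measurable_fun setT f ->
  (\int[mu]_(x in `[a n, b n]) (f x)%:E)%E @[n --> \oo] -->
    (\int[mu]_(x in `]0%R, +oo[) (f x)%:E)%E.
Proof.
move=> a0 adec binc acvg bcvg f0 mf.
have -> : `]0%R, +oo[%classic = \bigcup_n `[a n, b n]%classic.
  apply/seteqP; split=> x/=.
    rewrite in_itv/= andbT => x0.
    have : \forall n \near \oo, a n < x /\ x <= b n.
      near=> n; split; first by near: n; exact: (cvgr_lt 0 acvg).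
      by near: n; move/cvgryPge : bcvg; exact.
    case=> N _ /(_ N (leqnn _)) [aN bN].
    by exists N => //=; rewrite in_itv/= (ltW aN).
  by move=> [n _]/=; rewrite !in_itv/= andbT => /andP[/(lt_le_trans (a0 n))].
apply: ge0_nondecreasing_set_cvg_integral.
- move=> n m nm; rewrite subsetEset => x/=; rewrite !in_itv/= => /andP[ax xb].
  by rewrite (le_trans (adec _ _ nm) ax) (le_trans xb (binc _ _ nm)).
- by move=> n; exact: measurable_itv.
- by move=> n; apply/measurable_EFinP; exact: measurable_funTS.
- move=> n x/=; rewrite in_itv/= => /andP[ax _].
  by rewrite lee_fin f0// (lt_le_trans (a0 n)).
Unshelve. all: by end_near. Qed.

Definition Euler_integrand x t : R := t `^ (x - 1) * expR (- t).

Lemma measurable_Euler_integrand x : measurable_fun setT (Euler_integrand x).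
Proof.
apply: measurable_funM; first exact: measurable_powR.
by apply: measurableT_comp => //; exact: measurable_oppr.
Qed.

Lemma Euler_integrand_ge0 x t : 0 <= Euler_integrand x t.
Proof. by rewrite mulr_ge0 ?powR_ge0 ?expR_ge0. Qed.

(** The extended real value is kept because finiteness is itself deduced from the recurrence and
    from [eEuler_le]. *)
Definition eEuler x : \bar R :=
  (\int[mu]_(t in `]0%R, +oo[) (Euler_integrand x t)%:E)%E.

Lemma Euler_integralE x : Euler_integral x = fine (eEuler x).
Proof. by []. Qed.

Lemma eEuler_ge0 x : (0 <= eEuler x)%E.
Proof. by apply: integral_ge0 => t _; rewrite lee_fin Euler_integrand_ge0. Qed.

Let a (n : nat) : R := n.+1%:R^-1.
Let b (n : nat) : R := n.+1%:R.

Let a_gt0 n : 0 < a n. Proof. by rewrite invr_gt0. Qed.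

Let a_dec : {homo a : n m / (n <= m)%N >-> m <= n}.
Proof. by move=> n m nm; rewrite lef_pV2 ?posrE// ler_nat. Qed.

Let b_inc : {homo b : n m / (n <= m)%N >-> n <= m}.
Proof. by move=> n m nm; rewrite ler_nat. Qed.

Let a_cvg : a @ \oo --> 0.
Proof. exact: cvg_harmonic. Qed.

Let b_cvg : b @ \oo --> +oo.
Proof.
apply/cvgryPge => M; near=> n; rewrite (le_trans (_ : M <= n%:R))//.
  by near: n; exact: nbhs_infty_ger.
by rewrite ler_nat.
Unshelve. all: by end_near. Qed.

Lemma continuous_Euler_integrand x t : 0 < t ->
  {for t, continuous (Euler_integrand x)}.
Proof.
move=> t0; apply/differentiable_continuous/derivable1_diffP.
apply: derivableM; first by apply: derivable_powR; rewrite in_itv/= t0.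
by apply: ex_derive.
Qed.

Lemma cvg_harmonic_at_right : n.+1%:R^-1 @[n --> \oo] --> (0 : R)^'+.
Proof.
move=> A; rewrite /nbhs/= => -[e/= e0 eA]; near=> n.
apply: eA => //=.
by near: n; move/cvgrPdist_lt : a_cvg; exact.
Unshelve. all: by end_near. Qed.

Lemma Euler_integrand_cvg0 x : 0 < x ->
  Euler_integrand (x + 1) (a n) @[n --> \oo] --> 0.
Proof.
move=> x0.
have pa : a n `^ x @[n --> \oo] --> 0 by exact: (cvg_comp _ _ cvg_harmonic_at_right (powR_cvg0 x0)).
apply: (squeeze_cvgr _ (cvg_cst 0) pa); near=> n.
rewrite Euler_integrand_ge0/= /Euler_integrand addrK ler_piMr ?powR_ge0//.
by rewrite -expR0 ler_expR oppr_le0 ltW.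
Unshelve. all: by end_near. Qed.

Lemma powR_mul_expRN_le (x y : R) (k : nat) : x <= k%:R -> 1 <= y ->
  y `^ x * expR (- y) <= y^-1 * k.+1`!%:R.
Proof.
move=> kx y1; have y0 : 0 < y by lra.
rewrite expRN ler_pdivrMr ?expR_gt0//.
apply: le_trans (ler_powR y1 kx) _; rewrite powR_mulrn ?(ltW y0)//.
have f0 : 0 < k.+1`!%:R :> R by rewrite ltr0n fact_gt0.
move: (k.+1`!%:R) f0 (expR_ge1Dxn k (ltW y0)) => f f0 h.
have -> : y ^+ k = y^-1 * f * (y ^+ k.+1 / f).
  by rewrite exprS; move: (y ^+ k) => p; field; rewrite !gt_eqF.
rewrite ler_wpM2l//; first by rewrite mulr_ge0// ?invr_ge0 ltW.
lra.
Qed.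

Lemma Euler_integrand_cvgy x : 0 < x ->
  Euler_integrand (x + 1) (b n) @[n --> \oo] --> 0.
Proof.
move=> x0; have [k kx] : exists k : nat, x <= k%:R.
  by exists (Num.truncn x).+1; rewrite ltW// truncnS_gt.
have ub : a n * k.+1`!%:R @[n --> \oo] --> (0 : R).
  by rewrite -(mul0r (k.+1`!%:R : R)); apply: cvgMl; exact: a_cvg.
apply: (squeeze_cvgr _ (cvg_cst 0) ub); near=> n.
rewrite Euler_integrand_ge0/= /Euler_integrand addrK.
by apply: powR_mul_expRN_le => //; rewrite ler1n.
Unshelve. all: by end_near. Qed.

Lemma derivable_oo_LRcontinuous_gt0 (F : R -> R) (u v : R) :
  (forall t : R, 0 < t -> derivable F t 1) -> 0 < u -> u < v ->
  derivable_oo_LRcontinuous F u v.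
Proof.
move=> dF u0 uv.
have cF t : 0 < t -> {for t, continuous F}.
  by move=> t0; apply/differentiable_continuous/derivable1_diffP/dF.
split.
- by move=> t; rewrite in_itv/= => /andP[ut _]; apply: dF; exact: lt_trans ut.
- by apply: cvg_at_right_filter; exact: cF.
- by apply: cvg_at_left_filter; apply: cF; exact: lt_trans uv.
Qed.

Lemma continuous_within_gt0 (F : R -> R) (u v : R) :
  (forall t : R, 0 < t -> {for t, continuous F}) -> 0 < u ->
  {within `[u, v], continuous F}.
Proof.
move=> cF u0; apply: continuous_in_subspaceT => t; rewrite inE/= in_itv/=.
by move=> /andP[ut _]; apply: cF; exact: lt_le_trans ut.
Qed.

Lemma Euler_integrand_by_parts x (u v : R) : 0 < x -> 0 < u -> u < v ->
  (\int[mu]_(t in `[u, v]) (Euler_integrand (x + 1) t)%:E =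
   (Euler_integrand (x + 1) u - Euler_integrand (x + 1) v)%:E +
   x%:E * \int[mu]_(t in `[u, v]) (Euler_integrand x t)%:E)%E.
Proof.
move=> x0 u0 uv.
have dpow t : 0 < t -> is_derive t (1 : R) (fun t : R => t `^ x) (x * t `^ (x - 1)).
  by move=> t0; exact: is_derive1_powR.
have dexp (t : R) : is_derive t (1 : R) (fun t : R => - expR (- t)) (expR (- t)).
  have h : is_derive t (1 : R) (fun t : R => expR (- t)) (expR (- t) * -1).
    by apply: (@is_derive1_comp R expR (fun t => - t)).
  have h2 : is_derive t (1 : R) (fun t : R => - expR (- t)) _ := is_deriveN h.
  by apply: (is_derive_eq h2); rewrite mulrN1 opprK.
have := @integration_by_parts R (fun t => t `^ x) (fun t => - expR (- t))
   (fun t => x * t `^ (x - 1)) (fun t => expR (- t)) u v uv.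
move=> /(_ _ _ _ _ _ _) H.
under eq_integral do rewrite /Euler_integrand addrK.
rewrite H; last first.
- move=> t; rewrite in_itv/= => /andP[ut _]; rewrite derive1E.
  exact: (@derive_val _ _ _ _ _ _ _ (dexp t)).
- by apply: derivable_oo_LRcontinuous_gt0 => // t t0; case: (dexp t).
- apply: continuous_within_gt0 => // t t0.
  apply/differentiable_continuous/derivable1_diffP.
  by apply: ex_derive.
- move=> t; rewrite in_itv/= => /andP[ut _]; rewrite derive1E.
  exact: (@derive_val _ _ _ _ _ _ _ (dpow t (lt_trans u0 ut))).
- by apply: derivable_oo_LRcontinuous_gt0 => // t t0; case: (dpow t t0).
- apply: continuous_within_gt0 => // t t0.
  apply/differentiable_continuous/derivable1_diffP.
  apply: derivableM => //; apply: derivable_powR; rewrite in_itv/= t0//.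
rewrite /Euler_integrand addrK; congr (_ + _)%E.
  by congr EFin; ring.
rewrite -ge0_integralZl_EFin//; last 3 first.
- by move=> t _; rewrite lee_fin Euler_integrand_ge0.
- by apply/measurable_EFinP/measurable_funTS; exact: measurable_Euler_integrand.
- exact: ltW.
have -> : (\int[mu]_(t in `[u, v]) (x * t `^ (x - 1) * - expR (- t))%:E =
    \int[mu]_(t in `[u, v]) - (x * Euler_integrand x t)%:E)%E.
  by apply: eq_integral => t _; rewrite -EFinN; congr EFin; rewrite /Euler_integrand; ring.
rewrite integral_ge0N ?oppeK//.
by move=> t _; rewrite lee_fin mulr_ge0 ?Euler_integrand_ge0// ltW.
Qed.

Lemma eEuler_recurrence x : 0 < x -> eEuler (x + 1) = (x%:E * eEuler x)%E.
Proof.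
move=> x0.
have L1 := ge0_cvg_integral_0y a_gt0 a_dec b_inc a_cvg b_cvg
  (fun t _ => Euler_integrand_ge0 (x + 1) t) (measurable_Euler_integrand (x + 1)).
have L2 := ge0_cvg_integral_0y a_gt0 a_dec b_inc a_cvg b_cvg
  (fun t _ => Euler_integrand_ge0 x t) (measurable_Euler_integrand x).
apply: (cvg_unique _ L1) => //=.
have L3 : ((Euler_integrand (x + 1) (a n) - Euler_integrand (x + 1) (b n))%:E +
   x%:E * \int[mu]_(t in `[a n, b n]) (Euler_integrand x t)%:E)%E @[n --> \oo] -->
   (0%:E + x%:E * eEuler x)%E.
  apply: cvgeD; first by [].
    apply: cvg_EFin; first exact: nearW.
    by rewrite -(subr0 0); apply: cvgB; [exact: Euler_integrand_cvg0|exact: Euler_integrand_cvgy].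
  exact: cvgeZl.
rewrite add0e in L3; apply: cvg_trans L3; apply: near_eq_cvg; near=> n.
have n0 : (0 < n)%N by near: n; exact: nbhs_infty_gt.
have ab : a n < b n.
  apply: lt_le_trans (_ : 1 <= _); last by rewrite ler1n.
  by rewrite /a invf_lt1 ?ltr1n ?ltr0n.
by rewrite (Euler_integrand_by_parts x0 (a_gt0 n) ab).
Unshelve. all: by end_near. Qed.

Lemma eEuler1 : eEuler 1 = 1%E.
Proof.
have -> : eEuler 1 = (\int[mu]_(t in `]0%R, +oo[) (expR (- t))%:E)%E.
  by apply: eq_integral => t _; rewrite /Euler_integrand subrr powRr0 mul1r.
have mexp : measurable_fun setT (fun t : R => expR (- t)).
  by apply: measurableT_comp => //; exact: measurable_oppr.
have cexp : continuous (fun t : R => expR (- t)).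
  move=> t; apply: (@continuous_comp _ _ _ (fun t : R => - t) expR).
    exact: opp_continuous.
  exact: continuous_expR.
rewrite integral_itv_obnd_cbnd; last exact/measurable_EFinP/measurable_funTS.
have dexp (t : R) : is_derive t (1 : R) (fun t : R => - expR (- t)) (expR (- t)).
  have h : is_derive t (1 : R) (fun t : R => expR (- t)) (expR (- t) * -1).
    by apply: (@is_derive1_comp R expR (fun t => - t)).
  have h2 : is_derive t (1 : R) (fun t : R => - expR (- t)) _ := is_deriveN h.
  by apply: (is_derive_eq h2); rewrite mulrN1 opprK.
rewrite (@ge0_continuous_FTC2y R _ (fun t => - expR (- t)) 0 0).
- by rewrite oppr0 expR0 -EFinB sub0r opprK.
- by move=> t _; exact: expR_ge0.
- exact: continuous_subspaceT.
- by rewrite -oppr0; apply: cvgN; exact: cvgr_expR.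
- by move=> t _; case: (dexp t).
- apply: cvg_at_right_filter; apply: cvgN; exact: cexp.
- by move=> t _; rewrite derive1E; exact: (@derive_val _ _ _ _ _ _ _ (dexp t)).
Qed.

(** Put [L = ln (t/s)] and add [1 + y <= exp y] at [y = (1-c) L] and at [y = - c L], with weights
    [c exp(cL)] and [(1-c) exp(cL)]: the terms linear in [L] cancel. *)
Lemma powR_le_tangent (t s c : R) : 0 < t -> 0 < s -> 0 <= c <= 1 ->
  t `^ c <= s `^ c * ((1 - c) + c * (t / s)).
Proof.
move=> t0 s0 /andP[c0 c1].
have ts0 : 0 < t / s by rewrite divr_gt0.
have -> : t `^ c = s `^ c * (t / s) `^ c.
  by rewrite -powRM ?ltW// mulrC divfK// gt_eqF.
rewrite ler_wpM2l ?powR_ge0//.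
rewrite /powR gt_eqF// -[in leRHS](lnK ts0); move: (ln (t / s)) => L.
have E : expR L = expR (c * L) * expR ((1 - c) * L).
  by rewrite -expRD; congr expR; ring.
have E1 : 1 = expR (c * L) * expR (- (c * L)) by rewrite -expRD subrr expR0.
rewrite [in leRHS]E [X in X - c]E1.
have h1 := ler_wpM2l (mulr_ge0 c0 (expR_ge0 (c * L))) (expR_ge1Dx ((1 - c) * L)).
have c1' : 0 <= 1 - c by lra.
have h2 := ler_wpM2l (mulr_ge0 c1' (expR_ge0 (c * L))) (expR_ge1Dx (- (c * L))).
have h3 : expR (c * L) * expR (- (c * L)) = 1 by [].
have h4 : c * (expR (c * L) * expR (- (c * L))) = c by rewrite h3 mulr1.
move: h1 h2; rewrite h3; nra.
Qed.

Lemma Euler_integrand_le x (s c t : R) : 0 < t -> 0 < s -> 0 <= c <= 1 ->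
  Euler_integrand (x + c) t <= (1 - c) * s `^ c * Euler_integrand x t
    + c * s `^ c / s * Euler_integrand (x + 1) t.
Proof.
move=> t0 s0 c01; rewrite /Euler_integrand.
have -> : x + c - 1 = (x - 1) + c by ring.
have -> : x + 1 - 1 = (x - 1) + 1 by ring.
move: (x - 1) => y; rewrite !powRD ?(gt_eqF t0) ?implybT// powRr1 ?(ltW t0)//.
have := ler_wpM2l (mulr_ge0 (powR_ge0 t y) (expR_ge0 (- t)))
  (powR_le_tangent t0 s0 c01).
move: (t `^ y) (expR _) (s `^ c) (t `^ c) (s^-1) => A B C D E; lra.
Qed.

(** A substitute for Hoelder's inequality with a free point of tangency: [s = 1] serves for
    finiteness, while [s = x] merges both terms on the right into [x^c Gamma x], which is Wendel's
    inequality [Euler_integral_le]. *)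
Lemma eEuler_le x (s c : R) : 0 < s -> 0 <= c <= 1 ->
  (eEuler (x + c) <= ((1 - c) * s `^ c)%:E * eEuler x
     + (c * s `^ c / s)%:E * eEuler (x + 1))%E.
Proof.
move=> s0 c01; have /andP[c0 c1] := c01.
have m y : measurable_fun (`]0%R, +oo[%classic : set R) (EFin \o Euler_integrand y).
  by apply/measurable_EFinP/measurable_funTS; exact: measurable_Euler_integrand.
have k1 : 0 <= (1 - c) * s `^ c by rewrite mulr_ge0 ?powR_ge0 ?subr_ge0.
have k2 : 0 <= c * s `^ c / s by rewrite divr_ge0 ?mulr_ge0 ?powR_ge0// ltW.
have g y t : (0 <= (Euler_integrand y t)%:E)%E by rewrite lee_fin Euler_integrand_ge0.
rewrite /eEuler -!ge0_integralZl_EFin//; try exact: m.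
rewrite -ge0_integralD//; last 4 first.
- by move=> t _; rewrite mule_ge0.
- by apply: measurable_funeM; exact: m.
- by move=> t _; rewrite mule_ge0.
- by apply: measurable_funeM; exact: m.
apply: ge0_le_integral => //.
- exact: m.
- by apply: emeasurable_funD; apply: measurable_funeM; exact: m.
- move=> t; rewrite /= in_itv/= andbT => t0.
  by rewrite -!EFinM -EFinD lee_fin Euler_integrand_le.
Qed.

Lemma eEuler_fin_num x : 0 < x -> eEuler x \is a fin_num.
Proof.
have fin12 c : 0 <= c <= 1 -> eEuler (1 + c) \is a fin_num.
  move=> c01; rewrite ge0_fin_numE ?eEuler_ge0//.
  apply: le_lt_trans (eEuler_le 1 ltr01 c01) _.
  by rewrite eEuler_recurrence// eEuler1 !mule1 -EFinD ltry.
have fin01 y : 0 < y -> y <= 1 -> eEuler y \is a fin_num.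
  move=> y0 y1; have := fin12 y; rewrite (ltW y0) y1 addrC eEuler_recurrence//.
  move=> /(_ isT); rewrite !ge0_fin_numE ?mule_ge0 ?eEuler_ge0 ?lee_fin ?ltW//.
  by case: (eEuler y) => [r| |]//=; rewrite ?ltry// gt0_muley ?lte_fin.
suff H n : forall y, 0 < y -> y <= n.+1%:R -> eEuler y \is a fin_num.
  by move=> x0; apply: (H (Num.truncn x)) => //; rewrite ltW// truncnS_gt.
elim: n => [|n ih] y y0 yn; first exact: fin01.
have [y1|y1] := leP y 1; first exact: fin01.
have := ih (y - 1); rewrite subr_gt0 lerBlDr natr1 => /(_ y1 yn) h.
by rewrite -(subrK 1 y) eEuler_recurrence ?subr_gt0// fin_numM// ih// ?subr_gt0// lerBlDr natr1.
Qed.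

Lemma Euler_integralE' x : 0 < x -> (Euler_integral x)%:E = eEuler x.
Proof. by move=> x0; rewrite Euler_integralE fineK ?eEuler_fin_num. Qed.

Lemma Euler_integral_recurrence x : 0 < x ->
  Euler_integral (x + 1) = x * Euler_integral x.
Proof.
by move=> x0; rewrite !Euler_integralE eEuler_recurrence// fineM ?eEuler_fin_num.
Qed.

Lemma Euler_integral1 : Euler_integral (1 : R) = 1.
Proof. by rewrite Euler_integralE eEuler1. Qed.

Lemma Euler_integral_le x (c : R) : 0 < x -> 0 <= c <= 1 ->
  Euler_integral (x + c) <= Euler_integral x * x `^ c.
Proof.
move=> x0 c01; have /andP[c0 c1] := c01.
have xc0 : 0 < x + c by rewrite ltr_wpDr.
have x10 : 0 < x + 1 by rewrite addr_gt0.
have := eEuler_le x x0 c01.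
rewrite -!Euler_integralE'// -!EFinM -EFinD lee_fin Euler_integral_recurrence//.
move/le_trans; apply.
rewrite (_ : c * x `^ c / x * (x * Euler_integral x) = c * x `^ c * Euler_integral x).
  lra.
by field; rewrite gt_eqF.
Qed.

(* Substitute t = u^2 in the Gaussian integral. *)
Lemma Euler_integral_half : Euler_integral (2^-1 : R) = Num.sqrt pi.
Proof.
have a2_gt0 n : 0 < a n ^+ 2 by rewrite exprn_gt0.
have a2_dec : {homo (fun n => a n ^+ 2) : n m / (n <= m)%N >-> m <= n}.
  by move=> n m nm; rewrite lerXn2r ?nnegrE ?a_dec// ltW.
have b0 n : 0 < b n by rewrite ltr0n.
have b2_inc : {homo (fun n => b n ^+ 2) : n m / (n <= m)%N >-> n <= m}.
  by move=> n m nm; rewrite lerXn2r ?nnegrE ?b_inc// ltW.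
have a2_cvg : a n ^+ 2 @[n --> \oo] --> 0.
  by rewrite -(mulr0 0); apply: cvgM; exact: a_cvg.
have b2_cvg : b n ^+ 2 @[n --> \oo] --> +oo.
  apply/cvgryPge => M; near=> n; apply: (@le_trans _ _ (b n)).
    by near: n; move/cvgryPge : b_cvg; exact.
  by rewrite expr2; apply: ler_peMl; [exact: ltW|rewrite ler1n].
have L1 := ge0_cvg_integral_0y a2_gt0 a2_dec b2_inc a2_cvg b2_cvg
  (fun t _ => Euler_integrand_ge0 2^-1 t) (measurable_Euler_integrand 2^-1).
pose h (t : R) := 2 * expR (- (t ^+ 2)).
have h_ge0 t : 0 < t -> 0 <= h t by rewrite /h mulr_ge0 ?expR_ge0.
have mg : measurable_fun setT (fun t : R => expR (- (t ^+ 2))).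
  exact: measurable_gauss_fun.
have mh : measurable_fun setT h by apply: measurable_funM.
have L2 := ge0_cvg_integral_0y a_gt0 a_dec b_inc a_cvg b_cvg h_ge0 mh.
have dsq (t : R) : is_derive t (1 : R) (fun t : R => t ^+ 2) (2 * t).
  apply: trigger_derive; rewrite /GRing.scale/=; ring.
have dsqE : (fun t : R => t ^+ 2)^`()%classic = (fun t => 2 * t).
  by apply/funext => t; rewrite derive1E; exact: (@derive_val _ _ _ _ _ _ _ (dsq t)).
have c2 : continuous (fun t : R => 2 * t).
  by move=> t; apply: cvgM; [exact: cvg_cst|exact: cvg_id].
have sub n : (0 < n)%N -> (\int[mu]_(t in `[(a n ^+ 2)%R, (b n ^+ 2)%R]) (Euler_integrand 2^-1 t)%:E =
   \int[mu]_(t in `[a n, b n]) (h t)%:E)%E.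
  move=> n0.
  have ab : a n < b n.
    apply: lt_le_trans (_ : 1 <= _); last by rewrite ler1n.
    by rewrite /a invf_lt1 ?ltr1n ?ltr0n.
  rewrite (@integration_by_substitution_increasing _ (fun t => t ^+ 2) _ (a n) (b n) (ltW ab)).
  - apply: eq_integral => t; rewrite inE/= in_itv/= => /andP[ta _].
    have t0 : 0 < t by exact: lt_le_trans ta.
    congr EFin; rewrite fctE dsqE /h /= /Euler_integrand.
    have -> : 2^-1 - 1 = - 2^-1 :> R by field.
    rewrite powRN powR12_sqrt ?sqr_ge0// sqrtr_sqr gtr0_norm//.
    by move: (expR _) => E; field; rewrite gt_eqF.
  - move=> x y; rewrite !in_itv/= => /andP[ax _] /andP[ay _] xy.
    by rewrite ltrXn2r// ?nnegrE (le_trans (ltW (a_gt0 n))).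
  - by move=> t _; rewrite dsqE; exact: c2.
  - by rewrite dsqE; apply/cvg_ex; exists (2 * a n); apply: cvg_at_right_filter; exact: c2.
  - by rewrite dsqE; apply/cvg_ex; exists (2 * b n); apply: cvg_at_left_filter; exact: c2.
  - by apply: derivable_oo_LRcontinuous_gt0 => // t _; case: (dsq t).
  - by apply: continuous_within_gt0 => // t t0; exact: continuous_Euler_integrand.
have E : eEuler 2^-1 = (\int[mu]_(t in `]0%R, +oo[) (h t)%:E)%E.
  apply: esym; apply: (cvg_unique _ L2); first exact: ereal_hausdorff.
  apply: cvg_trans L1; apply: near_eq_cvg.
  near=> n; apply: sub; near: n; exact: nbhs_infty_gt.
rewrite Euler_integralE E integral_itv_obnd_cbnd; last first.
  by apply/measurable_EFinP/measurable_funTS; exact: mh.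
under eq_integral do rewrite /h EFinM.
rewrite ge0_integralZl_EFin//; last first.
  by apply/measurable_EFinP/measurable_funTS; exact: mg.
have I : (\int[mu]_(x in `[0%R, +oo[) (expR (- x ^+ 2))%:E = (Num.sqrt pi / 2)%:E)%E.
  exact: integral0y_gauss.
rewrite I.
by rewrite -EFinM/= mulrCA divff ?mulr1.
Unshelve. all: by end_near. Qed.

Lemma Euler_integral_rising x n : 0 < x ->
  Euler_integral (x + n%:R) = rising_factorial x n * Euler_integral x.
Proof.
move=> x0; elim: n => [|n ih]; first by rewrite addr0 /rising_factorial big_ord0 mul1r.
rewrite rising_factorialS -natr1 addrA Euler_integral_recurrence; last first.
  by rewrite ltr_wpDr.
by rewrite ih; ring.
Qed.

Lemma Euler_integral_fact n : Euler_integral (n.+1%:R : R) = n`!%:R.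
Proof.
elim: n => [|n ih]; first exact: Euler_integral1.
by rewrite -natr1 Euler_integral_recurrence// ih factS natrM.
Qed.

(** On []0, 1]] Wendel's inequality with [c = 1 - x] reads [1 = Gamma 1 <= Gamma x * x^(1-x)], which
    excludes the value 0; the recurrence extends this to larger [x]. *)
Lemma Euler_integral_gt0 x : 0 < x -> 0 < Euler_integral x.
Proof.
move=> x0.
suff : Euler_integral x != 0.
  move=> /negPf h; rewrite lt_neqAle eq_sym h /= Euler_integralE fine_ge0//.
  exact: eEuler_ge0.
have [n nx] : exists n : nat, x <= n.+1%:R.
  by exists (Num.truncn x); rewrite ltW// truncnS_gt.
elim: n x x0 nx => [|n ih] x x0 nx.
  have c01 : 0 <= 1 - x <= 1 by lra.
  apply/eqP => h; have := Euler_integral_le x0 c01.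
  by rewrite h mul0r subrKC Euler_integral1 ler10.
have [x1|x1] := leP x 1.
  have c01 : 0 <= 1 - x <= 1 by lra.
  apply/eqP => h; have := Euler_integral_le x0 c01.
  by rewrite h mul0r subrKC Euler_integral1 ler10.
rewrite -(subrK 1 x) Euler_integral_recurrence ?subr_gt0//.
by rewrite mulf_neq0 ?ih ?subr_gt0 ?subr_eq0 ?gt_eqF// lerBlDr natr1.
Qed.

(* Euler_integral_le, applied to n, c and to n + c, 1 - c, traps
   Euler_integral (n + c) between two equivalent bounds. *)
Lemma rising_binomial_cvg01 (c : R) : 0 < c < 1 ->
  rising_binomial c n * n%:R `^ (1 - c) @[n --> \oo] --> (Euler_integral c)^-1.
Proof.
move=> /andP[c0 c1]; have G0 := Euler_integral_gt0 c0.
rewrite (_ : (Euler_integral c)^-1 = (1 - 0) / Euler_integral c); last first.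
  by rewrite subr0 mul1r.
have lo : (1 - a n) / Euler_integral c @[n --> \oo] --> (1 - 0) / Euler_integral c.
  by apply: cvgMl; apply: cvgB; [exact: cvg_cst|exact: a_cvg].
have hi : 1 / Euler_integral c @[n --> \oo] --> (1 - 0) / Euler_integral c.
  by rewrite subr0; exact: cvg_cst.
apply: (squeeze_cvgr _ lo hi); near=> n.
have n0 : (0 < n)%N by near: n; exact: nbhs_infty_gt.
have nR : 0 < n%:R :> R by rewrite ltr0n.
have ncR : 0 < n%:R + c by rewrite addr_gt0.
have f0 : 0 < n`!%:R :> R by rewrite ltr0n fact_gt0.
have -> : rising_binomial c n = Euler_integral (n%:R + c) / n`!%:R / Euler_integral c.
  rewrite addrC Euler_integral_rising// /rising_binomial.
  by rewrite mulrAC mulfK// gt_eqF.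
rewrite mulrAC !ler_pM2r ?invr_gt0// mulrAC.
have up : Euler_integral (n%:R + c) * n%:R `^ (1 - c) <= n`!%:R.
  have c01 : 0 <= c <= 1 by lra.
  have := Euler_integral_le nR c01; rewrite -(ler_pM2r (powR_gt0 (1 - c) nR)).
  move/le_trans; apply; rewrite -mulrA -powRD ?(gt_eqF nR) ?implybT//.
  rewrite subrKC powRr1// mulrC -Euler_integral_recurrence// natr1.
  by rewrite Euler_integral_fact.
have dn : n`!%:R <= Euler_integral (n%:R + c) * (n%:R + c) `^ (1 - c).
  have c01 : 0 <= 1 - c <= 1 by lra.
  have := Euler_integral_le ncR c01.
  by rewrite -addrA subrKC natr1 Euler_integral_fact.
rewrite ler_pdivrMr// mul1r up andbT ler_pdivlMr//.
have q0 : 0 < n%:R / (n%:R + c) by rewrite divr_gt0.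
have q1 : n%:R / (n%:R + c) <= 1 by rewrite ler_pdivrMr// mul1r lerDl ltW.
have q2 : 1 - a n <= n%:R / (n%:R + c).
  have -> : 1 - a n = n%:R / (n%:R + 1).
    by rewrite /a -natr1; field; rewrite gt_eqF// addr_gt0.
  rewrite ler_pM2l// lef_pV2 ?posrE ?addr_gt0// lerD2l ltW//.
apply: le_trans (_ : (n%:R / (n%:R + c)) `^ (1 - c) * n`!%:R <= _).
  rewrite ler_pM2r//; apply: le_trans q2 _.
  by apply: ger1_powR; rewrite ?q0//; lra.
apply: le_trans (ler_wpM2l (powR_ge0 _ _) dn) _.
rewrite mulrCA -powRM ?(ltW ncR) ?(ltW q0)// divfK// gt_eqF//.
Unshelve. all: by end_near. Qed.

Lemma cvg_natrD_div (c : R) : (c + n%:R) / n%:R @[n --> \oo] --> (1 : R).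
Proof.
have h : 1 + c * n%:R^-1 @[n --> \oo] --> 1 + c * 0.
  apply: cvgD; first exact: cvg_cst.
  apply: cvgMr; rewrite -(cvg_shiftS (fun n : nat => n%:R^-1 : R)).
  exact: cvg_harmonic.
rewrite mulr0 addr0 in h; apply: cvg_trans h; apply: near_eq_cvg; near=> n.
have n0 : n%:R != 0 :> R by rewrite pnatr_eq0 -lt0n; near: n; exact: nbhs_infty_gt.
by rewrite mulrDl divff// addrC.
Unshelve. all: by end_near. Qed.

Lemma GammaE_gt0 x : 0 < x -> Gamma x = Euler_integral x.
Proof. by rewrite /Gamma => ->. Qed.

Lemma GammaE_lt0 x : -1 < x < 0 -> Gamma x = Euler_integral (x + 1) / x.
Proof.
move=> /andP[x1 x0]; rewrite /Gamma ltNge (ltW x0)/=.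
have -> : Num.truncn (- x) = 0%N by apply/truncn0Pn; rewrite -ltNge; lra.
by rewrite /rising_factorial big_ord1 addr0.
Qed.

(** The range contains [l], [1/2] and [l + 1/2]. Outside []0, 1[], a shift of [c] by one reduces to
    [rising_binomial_cvg01], except at [c = 1], where all brackets equal 1. *)
Lemma rising_binomial_cvg (c : R) : -1 < c < 2 -> c != 0 ->
  rising_binomial c n * n%:R `^ (1 - c) @[n --> \oo] --> (Gamma c)^-1.
Proof.
move=> /andP[c_gt c_lt] c0.
have [cn|cp|/eqP] := ltgtP c 0; last by rewrite (negPf c0).
- have c01 : 0 < c + 1 < 1 by lra.
  have -> : (Gamma c)^-1 = c * 1 * (Euler_integral (c + 1))^-1.
    by rewrite GammaE_lt0 ?c_gt// invf_div mulr1.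
  have h : c * ((c + n%:R) / n%:R)^-1 * (rising_binomial (c + 1) n * n%:R `^ (1 - (c + 1)))
     @[n --> \oo] --> c * 1^-1 * (Euler_integral (c + 1))^-1.
    apply: cvgM; last exact: rising_binomial_cvg01.
    by apply: cvgMr; apply: cvgV; [exact: oner_neq0|exact: cvg_natrD_div].
  rewrite invr1 in h; apply: cvg_trans h; apply: near_eq_cvg; near=> n.
  have n0 : 0 < n%:R :> R by rewrite ltr0n; near: n; exact: nbhs_infty_gt.
  have n1 : 1 <= n%:R :> R by rewrite ler1n; near: n; exact: nbhs_infty_gt.
  rewrite rising_binomial_shift// (_ : 1 - (c + 1) = (1 - c) - 1); last ring.
  rewrite powRB ?(gt_eqF n0) ?implybT// powRr1 ?ltW//.
  field; rewrite (gt_eqF n0) c0/= gt_eqF//; lra.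
- have [c1|c1|c1] := ltgtP c 1.
  + by rewrite GammaE_gt0//; apply: rising_binomial_cvg01; rewrite cp.
  + have c01 : 0 < c - 1 < 1 by lra.
    have -> : (Gamma c)^-1 = (c - 1)^-1 * 1 * (Euler_integral (c - 1))^-1.
      rewrite GammaE_gt0// -{1}(subrK 1 c) Euler_integral_recurrence ?subr_gt0//.
      by rewrite invfM mulr1.
    have h : (c - 1)^-1 * ((c - 1 + n%:R) / n%:R) * (rising_binomial (c - 1) n * n%:R `^ (1 - (c - 1)))
       @[n --> \oo] --> (c - 1)^-1 * 1 * (Euler_integral (c - 1))^-1.
      apply: cvgM; last exact: rising_binomial_cvg01.
      by apply: cvgMr; exact: cvg_natrD_div.
    apply: cvg_trans h; apply: near_eq_cvg; near=> n.
    have n0 : 0 < n%:R :> R by rewrite ltr0n; near: n; exact: nbhs_infty_gt.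
    have c10 : c - 1 != 0 by rewrite gt_eqF// subr_gt0.
    have -> : rising_binomial c n = rising_binomial (c - 1) n * (c - 1 + n%:R) / (c - 1).
      by rewrite -rising_binomial_shift// subrK.
    rewrite (_ : 1 - (c - 1) = (1 - c) + 1); last ring.
    rewrite powRD ?(gt_eqF n0) ?implybT// powRr1 ?ltW//.
    by field; rewrite (gt_eqF n0) c10.
  + rewrite c1 GammaE_gt0// Euler_integral1 subrr invr1.
    apply: cvg_near_cst; near=> n; rewrite powRr0 mulr1.
    elim: {+}n => [|k ih]; first by rewrite rising_binomial0.
    by rewrite rising_binomialS ih mul1r nat1r divff// pnatr_eq0.
Unshelve. all: by end_near. Qed.

Lemma Gamma_half : Gamma (2^-1 : R) = Num.sqrt pi.
Proof. by rewrite GammaE_gt0 ?invr_gt0// Euler_integral_half. Qed.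

End Euler_integral_theory.

(** * Boundary terms *)

Section uniform_vanishing.
Context {R : realType}.
Implicit Types (r c K : R) (f g : nat -> R -> R).

Definition unif0 r f := forall e : R, 0 < e ->
  \forall N \near \oo, forall x, `|x| <= r -> `|f N x| <= e.

Lemma unif0_le (d : nat -> R) r f : d @ \oo --> (0 : R) ->
  (\forall N \near \oo, forall x, `|x| <= r -> `|f N x| <= d N) -> unif0 r f.
Proof.
move=> d0 fd e e0; have de : \forall N \near \oo, d N <= e.
  exact: (cvgr_le 0 d0).
by apply: filterS2 fd de => N fN dN x xr; exact: le_trans (fN x xr) dN.
Qed.

Lemma unif0D r f g : unif0 r f -> unif0 r g -> unif0 r (fun N x => f N x + g N x).
Proof.
move=> f0 g0 e e0; have e2 : 0 < e / 2 by rewrite divr_gt0.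
apply: filterS2 (f0 _ e2) (g0 _ e2) => N fN gN x xr.
by apply: le_trans (ler_normD _ _) _; rewrite (splitr e) lerD ?fN ?gN.
Qed.

Lemma unif0N r f : unif0 r f -> unif0 r (fun N x => - f N x).
Proof.
by move=> f0 e e0; apply: filterS (f0 e e0) => N fN x xr; rewrite normrN fN.
Qed.

Lemma unif0M r K (h : R -> R) f : (forall x, `|x| <= r -> `|h x| <= K) ->
  unif0 r f -> unif0 r (fun N x => h x * f N x).
Proof.
move=> hK f0 e e0; pose K1 := `|K| + 1.
have K10 : 0 < K1 by rewrite ltr_wpDl.
have eK : 0 < e / K1 by rewrite divr_gt0.
apply: filterS (f0 _ eK) => N fN x xr; rewrite normrM.
apply: le_trans (_ : K1 * (e / K1) <= _); last by rewrite mulrC divfK// gt_eqF.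
apply: ler_pM => //; last exact: fN.
by rewrite (le_trans (hK x xr))// (le_trans (ler_norm _))// lerDl.
Qed.

Lemma eq_unif0 r f g : (forall N x, `|x| <= r -> f N x = g N x) ->
  unif0 r f -> unif0 r g.
Proof.
move=> fg f0 e e0; apply: filterS (f0 e e0) => N H x xr.
by rewrite -fg// H.
Qed.

Lemma unif0_shift r f : unif0 r f -> unif0 r (fun N => f N.+1).
Proof.
move=> f0 e e0; have [N _ H] := f0 e e0; exists N => // n Nn.
by apply: H => /=; exact: leq_trans Nn (leqnSn n).
Qed.

Lemma cvg_unif0 r (u : nat -> R) : u @ \oo --> (0 : R) -> unif0 r (fun N _ => u N).
Proof.
move=> u0; apply: (@unif0_le (fun N => `|u N|)); last by apply: nearW.
by rewrite -(normr0 R); exact: cvg_norm.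
Qed.

Lemma unif0_cvg r f x : `|x| <= r -> unif0 r f -> f N x @[N --> \oo] --> (0 : R).
Proof.
move=> xr f0; apply/cvgr0Pnorm_le => e e0.
by apply: filterS (f0 e e0) => N; exact.
Qed.

(** One bound for both signs of the exponent. *)
Lemma powR_le_normN (y0 y p : R) : 0 < y0 -> y0 <= y -> y <= 1 ->
  y `^ p <= y0 `^ (- `|p|).
Proof.
move=> y00 y0y y1; have y_gt0 : 0 < y by exact: lt_le_trans y0y.
apply: le_trans (_ : y `^ (- `|p|) <= _).
  by apply: ger_powR; rewrite ?y_gt0// lerNl -normrN ler_norm.
rewrite !powRN lef_pV2 ?posrE ?powR_gt0//.
by rewrite ge0_ler_powR// ?nnegrE ltW.
Qed.

End uniform_vanishing.

(** * Asymptotics of the coefficients *)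

Section asymptotics.
Context {R : realType} (l : R).
Hypotheses (l_gt : - 2^-1 < l) (l_lt1 : l < 1) (l_neq0 : l != 0).

Local Notation g := (rising_binomial l).
Local Notation e := (geg_e l).

(** The limit of [e (2p) * g p]; the power of 2 comes from the asymptotics of [g] at [2p]. *)
Definition geg_W : R := 2 `^ l * Gamma (l + 2^-1) / (Gamma l * Num.sqrt pi).

Lemma cvg_muln2 : (fun p : nat => (p + p)%N) @ \oo --> \oo.
Proof.
apply/cvgnyPge => M; near=> p; apply: (@leq_trans p); last exact: leq_addr.
by near: p; exact: nbhs_infty_ge.
Unshelve. all: by end_near. Qed.

Lemma rising_binomial_cvg0 : g @ \oo --> (0 : R).
Proof.
have l1 : 0 < 1 - l by rewrite subr_gt0.
have l02 : -1 < l < 2 by move: l_gt l_lt1; lra.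
have H := rising_binomial_cvg l02 l_neq0.
have P : n.+1%:R^-1 `^ (1 - l) @[n --> \oo] --> (0 : R).
  exact: (cvg_comp _ _ cvg_harmonic_at_right (powR_cvg0 l1)).
have H1 : g n.+1 * n.+1%:R `^ (1 - l) @[n --> \oo] --> (Gamma l)^-1.
  by rewrite (cvg_shiftS (fun n => g n * n%:R `^ (1 - l))).
have H2 : g n.+1 * n.+1%:R `^ (1 - l) * n.+1%:R^-1 `^ (1 - l) @[n --> \oo] -->
    (Gamma l)^-1 * 0 by exact: cvgM.
rewrite mulr0 in H2.
rewrite -cvg_shiftS; apply: cvg_trans H2; apply: near_eq_cvg; near=> n.
rewrite -mulrA -powRM// divff ?pnatr_eq0// powR1 mulr1//.
Unshelve. all: by end_near. Qed.

(** The duplication of brackets removes [<2l, 2p>], so that the limit comes out directly in terms of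
    [Gamma (l + 1/2)] and [Gamma (1/2)]. *)
Lemma geg_e_double p : e (p + p) * g p =
  (l + (p + p)%:R) * g (p + p) * rising_binomial 2^-1 p / rising_binomial (l + 2^-1) p.
Proof.
have d := rising_binomial_double l p.
have n2l k : 2 * l + k%:R != 0.
  case: k => [|k]; first by rewrite addr0 mulf_neq0.
  by apply: lt0r_neq0; rewrite -natr1; have := ler0n R k; move: l_gt; lra.
have h1 := rising_binomial_neq0 (p + p) n2l.
have h2 : rising_binomial (l + 2^-1) p != 0.
  apply: rising_binomial_neq0 => k; apply: lt0r_neq0.
  by have := ler0n R k; move: l_gt; lra.
apply: (mulIf h2); apply: (mulIf h1); rewrite divfK// /geg_e.
rewrite -[RHS]mulrA [X in _ = _ * X]mulrC d.
by field.
Qed.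

Lemma geg_e_double_cvg : e (p + p) * g p @[p --> \oo] --> geg_W.
Proof.
have l02 : -1 < l < 2 by move: l_gt l_lt1; lra.
have l02' : -1 < l + 2^-1 < 2 by move: l_gt l_lt1; lra.
have l12 : l + 2^-1 != 0 by apply: lt0r_neq0; move: l_gt; lra.
have h12 : -1 < (2^-1 : R) < 2 by lra.
have h10 : 2^-1 != 0 :> R by [].
have H1 := cvg_comp _ _ cvg_muln2 (rising_binomial_cvg l02 l_neq0).
have H2 := rising_binomial_cvg h12 h10.
have H3 := rising_binomial_cvg l02' l12.
have H4 := cvg_comp _ _ cvg_muln2 (cvg_natrD_div l).
have G0 : (Gamma (l + 2^-1))^-1 != 0.
  rewrite invr_eq0 GammaE_gt0; last by move: l_gt; lra.
  by rewrite gt_eqF// Euler_integral_gt0//; move: l_gt; lra.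
have W : geg_W = 2 `^ l * (1 * (Gamma l)^-1 * (Gamma 2^-1)^-1 * ((Gamma (l + 2^-1))^-1)^-1).
  by rewrite /geg_W Gamma_half invrK invfM; ring.
rewrite W.
have H : 2 `^ l * ((((fun n => (l + n%:R) / n%:R) \o (fun p : nat => (p + p)%N)) p) *
   (((fun n => g n * n%:R `^ (1 - l)) \o (fun p : nat => (p + p)%N)) p) *
   (rising_binomial 2^-1 p * p%:R `^ (1 - 2^-1)) *
   (rising_binomial (l + 2^-1) p * p%:R `^ (1 - (l + 2^-1)))^-1)
   @[p --> \oo] --> 2 `^ l * (1 * (Gamma l)^-1 * (Gamma 2^-1)^-1 * ((Gamma (l + 2^-1))^-1)^-1).
  apply: cvgMr; apply: cvgM; last exact: cvgV.
  by apply: cvgM => //; apply: cvgM.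
apply: cvg_trans H; apply: near_eq_cvg; near=> p.
have p0 : 0 < p%:R :> R by rewrite ltr0n; near: p; exact: nbhs_infty_gt.
have h2 : rising_binomial (l + 2^-1) p != 0.
  apply: rising_binomial_neq0 => k; apply: lt0r_neq0.
  by have := ler0n R k; move: l_gt; lra.
rewrite geg_e_double /= natrD.
have -> : p%:R + p%:R = 2 * p%:R :> R by ring.
rewrite !powRM ?(ltW p0)//.
have -> : 1 - 2^-1 = 2^-1 :> R by field.
have -> : p%:R `^ (1 - l) = p%:R / p%:R `^ l.
  by rewrite powRB ?powRr1 ?(ltW p0)// (gt_eqF p0) implybT.
have -> : 2 `^ (1 - l) = 2 / 2 `^ l :> R.
  by rewrite powRB ?powRr1// pnatr_eq0 implybT.
have -> : p%:R `^ (1 - (l + 2^-1)) = p%:R `^ 2^-1 / p%:R `^ l.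
  rewrite -powRB; last by rewrite (gt_eqF p0) implybT.
  by congr (_ `^ _); field.
have : p%:R `^ l != 0 by rewrite lt0r_neq0// powR_gt0.
have : (p%:R : R) `^ 2^-1 != 0 by rewrite lt0r_neq0// powR_gt0.
have : 2 `^ l != 0 :> R by rewrite lt0r_neq0// powR_gt0.
move: (p%:R `^ l) (p%:R `^ 2^-1) (2 `^ l) p0 h2 => A B C p0 h2 C0 B0 A0.
move: (g _) (rising_binomial 2^-1 p) (rising_binomial (l + 2^-1) p) h2 => X Z Y Y0.
by field; rewrite A0 B0 C0 Y0 (gt_eqF p0).
Unshelve. all: by end_near. Qed.

Lemma geg_e_bounded m : exists2 M : R, 0 <= M &
  forall N, (0 < N)%N -> `|g N * e (m + 2 * N)| <= M.
Proof.
elim: m => [|m [M M0 IH]].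
  have cv : cvgn (fun p => e (p + p) * g p) by apply/cvg_ex; exists geg_W; exact: geg_e_double_cvg.
  have [K [Kreal Kf]] := cvg_seq_bounded cv.
  exists `|K + 1| => // N _; rewrite add0n mul2n -addnn mulrC.
  apply: le_trans (ler_norm (K + 1)); apply: (Kf (K + 1)) => //.
  by rewrite ltrDl.
(* The ratio [e (k+1) / e k = (l+k+1) / (2l+k)] is at most 4 as soon as [k >= 2], which [0 < N]
   guarantees. *)
exists (M * 4); first by rewrite mulr_ge0.
move=> N N0; rewrite addSn (geg_eS l_gt l_neq0) (mulrA (g N)) normrM.
apply: ler_pM; rewrite ?normr_ge0 ?IH//.
have k2 : 2 <= (m + 2 * N)%:R :> R.
  by rewrite ler_nat mul2n -addnn (leq_trans _ (leq_addl _ _))// (leq_add N0 N0).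
rewrite -natr1 normrM normfV !ger0_norm; try by move: l_gt; lra.
by rewrite ler_pdivrMr; move: l_gt l_lt1; lra.
Qed.

End asymptotics.

(** * The boundary terms of the partial sums vanish locally uniformly *)

Section boundary_terms.
Context {R : realType} (l : R).
Hypotheses (l_gt : - 2^-1 < l) (l_lt1 : l < 1) (l_neq0 : l != 0).

Local Notation g := (rising_binomial l).
Local Notation e := (geg_e l).
Local Notation S := (geg_sum l).

Lemma cvg0_mul_bounded (u h : nat -> R) (K : R) : u @ \oo --> (0 : R) ->
  (forall N, (0 < N)%N -> `|h N| <= K) -> u N * h N @[N --> \oo] --> (0 : R).
Proof.
move=> u0 hK.
have uK : `|u N| * K @[N --> \oo] --> (0 : R).
  rewrite -(mul0r K); apply: cvgMl; rewrite -(normr0 R); exact: cvg_norm.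
have uK' : - (`|u N| * K) @[N --> \oo] --> (0 : R).
  by rewrite -oppr0; exact: cvgN.
apply: (squeeze_cvgr _ uK' uK); near=> N; rewrite -ler_norml normrM ler_wpM2l//.
by apply: hK; near: N; exact: nbhs_infty_gt.
Unshelve. all: by end_near. Qed.

(** The common shape of the boundary terms: one factor [g N] compensates the growth of [e], and the
    other bracket, put into [c], provides the decay. *)
Lemma geg_v_unif0 (r : R) m (c : nat -> R) : 0 <= r < 1 -> c @ \oo --> (0 : R) ->
  unif0 r (fun N x => c N * g N * geg_v l (m + 2 * N) x).
Proof.
move=> r01 c0.
have [M M0 eM] := geg_e_bounded l_gt l_lt1 l_neq0 m.
have [B B0 uB] := geg_u_locally_bounded l_gt l_lt1 l_neq0 r01.
have cMB : `|c N| * (M * B) @[N --> \oo] --> (0 : R).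
  rewrite -(mul0r (M * B)); apply: cvgMl; rewrite -(normr0 R); exact: cvg_norm.
apply: (unif0_le cMB); near=> N => x xr.
have N0 : (0 < N)%N by near: N; exact: nbhs_infty_gt.
rewrite /geg_v (_ : _ * _ = c N *
  ((g N * e (m + 2 * N)) * (geg_u l (m + 2 * N)).[x])); last by ring.
by rewrite normrM ler_wpM2l// normrM ler_pM// ?eM// uB.
Unshelve. all: by end_near. Qed.

Lemma geg_sum1_unif0 (r : R) : 0 <= r < 1 ->
  unif0 r (fun N x => 2 * S 1 N.+1 x - 2 * x * S 0 N.+1 x).
Proof.
move=> r01.
(* One factor of [g N.+1 ^+ 2] is rewritten through [g N], as [geg_v_unif0] requires; [h] collects
   the remaining rational factors. *)
pose h (N : nat) := 2 * (l + N%:R) / (l + (2 * N).+1%:R).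
have c0 : g N.+1 * h N @[N --> \oo] --> (0 : R).
  apply: (@cvg0_mul_bounded _ _ 2); first by rewrite cvg_shiftS; exact: rising_binomial_cvg0.
  move=> N N0; have N1 : 1 <= N%:R :> R by rewrite ler1n.
  rewrite /h -[(2 * N).+1%:R]natr1 natrM normrM normfV !ger0_norm; try by move: l_gt l_lt1; lra.
  by rewrite ler_pdivrMr; move: l_gt l_lt1; lra.
apply: eq_unif0 (geg_v_unif0 1 r01 c0) => N x xr.
rewrite (geg_sum_rec0 l_gt l_neq0) addrAC subrr add0r add1n.
rewrite expr2 [X in _ = _ * X * _ * _]rising_binomialS.
rewrite /h; field.
apply/andP; split; apply: lt0r_neq0; have := ler0n R N; move: l_gt; lra.
Qed.

Lemma geg_sum_rec_unif0 (r : R) m : 0 <= r < 1 ->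
  unif0 r (fun N x => S m.+2 N x + S m N x - 2 * x * S m.+1 N x).
Proof.
move=> r01.
pose h (N : nat) := (l + (m + N)%:R) * (m.+1 + 2 * N)%:R
      / ((m.+1 + N)%:R * (l + (m + 2 * N)%:R)) - 1.
have c0 : g (m + N) * h N @[N --> \oo] --> (0 : R).
  apply: (@cvg0_mul_bounded _ _ 4).
    exact: (cvg_comp _ _ (cvg_addnl m) (rising_binomial_cvg0 l_gt l_lt1 l_neq0)).
  move=> N N0; have N1 : 1 <= N%:R :> R by rewrite ler1n.
  have m0 := ler0n R m.
  rewrite /h.
  have d0 : 0 < (m.+1 + N)%:R * (l + (m + 2 * N)%:R).
    rewrite mulr_gt0//; rewrite natrD natrM; move: l_gt; lra.
  rewrite ler_norml; apply/andP; split.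
    rewrite (@le_trans _ _ (0 - 1))//; first lra.
    rewrite lerD2r; apply: divr_ge0; last exact: ltW.
    apply: mulr_ge0 => //.
    by rewrite natrD; move: l_gt; lra.
  rewrite lerBlDr ler_pdivrMr//.
  rewrite !addSn -[(m + 2 * N).+1%:R]natr1 -[(m + N).+1%:R]natr1 (natrD _ m (2 * N)) natrM.
  rewrite (natrD _ m N); move: l_gt l_lt1 => ? ?.
  have h1 : l + (m%:R + N%:R) <= m%:R + N%:R + 1 by lra.
  have h2 : m%:R + 2 * N%:R + 1 <= (4 + 1) * (l + (m%:R + 2 * N%:R)) by lra.
  apply: le_trans (ler_pM _ _ h1 h2) _; [lra|lra|]; lra.
apply: eq_unif0 (geg_v_unif0 m r01 c0) => N x xr.
by rewrite (geg_sum_rec l_gt l_neq0) addrAC subrr add0r /h; ring.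
Qed.

Lemma geg_sum02_unif0 (r : R) : 0 <= r < 1 ->
  unif0 r (fun N x => S 0 N.+1 x - S 2 N.+1 x
    - (2 * l - 1 + 4 * (l - 1) * (geg_G l N.+1).[x])).
Proof.
move=> r01.
pose h (N : nat) := (2 * l + (2 * N).+1%:R) / ((2 * N).+2%:R * (l + (2 * N).+2%:R)).
pose c (N : nat) := - g N.+2 + (- 2 * (l - 1)) * (g N.+1 * h N).
have g0 := rising_binomial_cvg0 l_gt l_lt1 l_neq0.
have c0 : c @ \oo --> (0 : R).
  rewrite (_ : 0 = - 0 + (- 2 * (l - 1)) * 0); last by ring.
  apply: cvgD; first by apply: cvgN; exact: (cvg_comp _ _ (cvg_addnl 2) g0).
  apply: cvgMr; apply: (@cvg0_mul_bounded _ _ 2); first by rewrite cvg_shiftS.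
  move=> N N0; have N1 : 1 <= N%:R :> R by rewrite ler1n.
  rewrite /h -[(2 * N).+2%:R]natr1 -[(2 * N).+1%:R]natr1 natrM; move: l_gt l_lt1 => ? ?.
  rewrite ger0_norm; last by rewrite divr_ge0 ?mulr_ge0; lra.
  rewrite ler_pdivrMr; last by rewrite mulr_gt0; lra.
  nra.
apply: eq_unif0 (geg_v_unif0 2 r01 c0) => N x xr.
rewrite (geg_sum02 l_gt l_neq0) add2n /c /h; ring.
Qed.

(* Phi below is (1 - x^2)^l S_0 up to a boundary term, and its derivative df
   only involves boundary terms. *)
Lemma geg_sum0_unif0 (r : R) : 0 <= r < 1 ->
  unif0 r (fun N x => (1 - x ^+ 2) `^ l * S 0 N.+1 x - S 0 N.+1 0).
Proof.
move=> r01; have /andP[r0 r1] := r01.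
pose b1 N x := 2 * S 1 N.+1 x - 2 * x * S 0 N.+1 x.
pose b2 N x := S 2 N.+1 x + S 0 N.+1 x - 2 * x * S 1 N.+1 x.
pose k N x := S 0 N.+1 x - S 2 N.+1 x - (2 * l - 1 + 4 * (l - 1) * (geg_G l N.+1).[x]).
pose E N x := 2^-1 * (2 * l - 1) + 2 * (l - 1) * (geg_G l N.+1).[x].
pose B N x := (1 - x ^+ 2) * S 0 N.+1 x - E N x.
(* In this combination [S_2] and [S_1] cancel, which leaves [(1 - x^2) S_0 - E]. *)
have BE N x : 2^-1 * (k N x + b2 N x + x * b1 N x) = B N x.
  by rewrite /B /E /k /b2 /b1; field.
have xr1 (x : R) : `|x| <= r -> `|x| <= 1 by move=> /le_trans; apply; exact: ltW.
have hb1 : unif0 r b1 := geg_sum1_unif0 r01.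
have hb2 : unif0 r b2 := unif0_shift (geg_sum_rec_unif0 0 r01).
have hk : unif0 r k := geg_sum02_unif0 r01.
have hB : unif0 r B.
  apply: (eq_unif0 (fun N x _ => BE N x)).
  apply: (@unif0M _ _ `|2^-1| (fun=> 2^-1)) => //.
  apply: (unif0D (unif0D hk hb2)).
  exact: (@unif0M _ _ 1 id b1 xr1 hb1).
pose q (x : R) := 1 - x ^+ 2.
have y00 : 0 < q r by rewrite /q; nra.
have qr x : `|x| <= r -> q r <= q x /\ q x <= 1.
  move=> xr; rewrite /q lerD2l lerN2 -[x ^+ 2]real_normK ?num_real//; split.
    by rewrite lerXn2r ?nnegrE.
  by rewrite gerBl sqr_ge0.
have qp x : `|x| <= r -> 0 < q x by move=> /qr[/(lt_le_trans y00)].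
(* The derivative of [q^(l-1) E] is [2 (l-1) q^(l-2) (q S_1 - x E)]. Substituting [E = q S_0 - B]
   and [S_1 = x S_0 + b1/2] cancels [S_0]. *)
pose df N x := q x `^ (l - 1 - 1) * (2 * (l - 1) * (x * B N x + 2^-1 * (q x * b1 N x))).
have hdf : unif0 r df.
  apply: (@unif0M _ _ (q r `^ (- `|l - 1 - 1|)) (fun x => q x `^ (l - 1 - 1))).
    move=> x xr; have [qr1 q1] := qr x xr; rewrite ger0_norm ?powR_ge0//.
    exact: powR_le_normN.
  apply: (@unif0M _ _ `|2 * (l - 1)| (fun=> 2 * (l - 1))) => //.
  apply: (unif0D (@unif0M _ _ 1 id B xr1 hB)).
  apply: (@unif0M _ _ `|2^-1| (fun=> 2^-1)) => //.
  apply: (@unif0M _ _ 1 q) => // x xr; have [_ q1] := qr x xr.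
  by rewrite ger0_norm// ltW// qp.
pose Phi N (x : R) := q x `^ (l - 1) * E N x.
have dPhi N (y : R) : `|y| <= r -> is_derive y (1 : R) (Phi N) (df N y).
  move=> yr.
  have qd : is_derive y (1 : R) q (- (2 * y)).
    by apply: trigger_derive; rewrite /GRing.scale/=; ring.
  have Ed : is_derive y (1 : R) (E N) (2 * (l - 1) * S 1 N.+1 y).
    have H : is_derive y (1 : R) (fun x => (geg_G l N.+1).[x]) (S 1 N.+1 y).
      rewrite -(deriv_geg_G l_gt l_neq0); exact: is_derive_poly.
    rewrite /E; apply: trigger_derive; rewrite /GRing.scale/=; ring.
  apply: (is_derive_eq (is_derive_powR_mul (l - 1) (qp y yr) qd Ed)).
  by rewrite /df /B /b1 /q; congr (_ * _); field.
have hPhi : unif0 r (fun N x => Phi N x - Phi N 0).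
  move=> eps eps0; apply: filterS (hdf eps eps0) => N dfN x xr.
  have := norm_sub_le_derive (@dPhi N) dfN xr (_ : `|0| <= r).
  rewrite normr0 subr0 => /(_ r0)/le_trans; apply.
  by rewrite ler_piMr ?(ltW eps0)// xr1.
have q01 : q 0 = 1 by rewrite /q expr0n subr0.
apply: (@eq_unif0 _ _ (fun N x => (Phi N x - Phi N 0) + (q x `^ (l - 1) * B N x - B N 0))).
  move=> N x xr; rewrite /Phi.
  have -> : (1 - x ^+ 2) `^ l = q x `^ (l - 1) * q x.
    rewrite -{2}(powRr1 (ltW (qp x xr))) -powRD ?subrK//.
    by rewrite (gt_eqF (qp x xr)) implybT.
  rewrite /B -/(q x) -/(q 0) q01 powR1; ring.
apply: unif0D => //.
have hB0 : unif0 r (fun N _ => - B N 0).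
  have zr : `|0 : R| <= r by rewrite normr0.
  exact: (unif0N (cvg_unif0 r (unif0_cvg zr hB))).
apply: unif0D hB0.
apply: (@unif0M _ _ (q r `^ (- `|l - 1|)) (fun x => q x `^ (l - 1))) => //.
move=> x xr; have [qr1 q1] := qr x xr; rewrite ger0_norm ?powR_ge0//.
exact: powR_le_normN.
Qed.

End boundary_terms.

(** * The value at 0 *)

Section value_at_0.
Context {R : realType} (l : R).
Hypotheses (l_gt : - 2^-1 < l) (l_lt1 : l < 1) (l_neq0 : l != 0).

Local Notation g := (rising_binomial l).
Local Notation e := (geg_e l).
Local Notation S := (geg_sum l).

(** The sum has the form [t a_0] with [0 <= t <= 1]: prepending a term turns [t] into [1 - t rho_0].
    Ratios instead of monotonicity leave the sign of [a] free. *)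
Lemma alternating_sum_le (a rho : nat -> R) N :
  (forall n, a n.+1 = rho n * a n) -> (forall n, 0 <= rho n <= 1) ->
  `|\sum_(0 <= k < N) (-1) ^+ k * a k| <= `|a 0%N|.
Proof.
move=> aS rho01.
suff [t /andP[t0 t1] ->] : exists2 t, 0 <= t <= 1 &
    \sum_(0 <= k < N) (-1) ^+ k * a k = t * a 0%N.
  by rewrite normrM ger0_norm// ler_piMl.
elim: N a rho aS rho01 => [|N IH] a rho aS rho01.
  by exists 0; rewrite ?lexx ?ler01// big_geq// mul0r.
have [t /andP[t0 t1] E] := IH (a \o succn) (rho \o succn) (fun n => aS n.+1)
  (fun n => rho01 n.+1).
exists (1 - t * rho 0%N).
  by have /andP[r0 r1] := rho01 0%N; apply/andP; split; nra.
rewrite big_nat_recl// expr0 mul1r.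
under eq_bigr do rewrite exprS -mulrA mulN1r.
by rewrite sumrN E /= aS; ring.
Qed.

Lemma alternating_tail_le (a rho : nat -> R) n0 N :
  (forall n, (n0 <= n)%N -> a n.+1 = rho n * a n) ->
  (forall n, (n0 <= n)%N -> 0 <= rho n <= 1) -> (n0 <= N)%N ->
  `|\sum_(0 <= k < N) (-1) ^+ k * a k - \sum_(0 <= k < n0) (-1) ^+ k * a k|
    <= `|a n0|.
Proof.
move=> aS rho01 n0N; rewrite (big_cat_nat (leq0n n0) n0N)/= addrC addrK.
rewrite -{1}[n0]add0n big_addn.
under eq_bigr do rewrite exprD mulrAC.
rewrite -mulr_suml normrM normrX normrN1 expr1n mulr1.
apply: (@alternating_sum_le (fun k => a (k + n0)%N) (fun k => rho (k + n0)%N)) => k.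
- by rewrite addSn aS// leq_addl.
- by rewrite rho01// leq_addl.
Qed.

Lemma geg_u_odd0 q : (geg_u l q.*2.+1).[0] = 0.
Proof.
elim: q => [|q ih]; first by rewrite horner_geg_u1 mulr0.
by rewrite doubleS horner_geg_uSS ih !mulr0 mul0r subrr.
Qed.

Lemma geg_c_even0 q : g q.*2 * (geg_u l q.*2).[0] = (-1) ^+ q * g q.
Proof.
elim: q => [|q ih]; first by rewrite rising_binomial0 horner_geg_u0 expr0.
rewrite doubleS horner_geg_uSS geg_u_odd0 mulr0 sub0r.
have -> : (-1) ^+ q.+1 * g q.+1 = - ((-1) ^+ q * g q * ((l + q%:R) / q.+1%:R)).
  by rewrite exprS rising_binomialS; ring.
rewrite -ih !(rising_binomialS _ q.*2.+1) !(rising_binomialS _ q.*2) /geg_q.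
have q0 := ler0n R q.
have h1 : l + q.*2%:R != 0.
  case: (q) q0 => [|q'] q0'; first by rewrite addr0.
  apply: lt0r_neq0; rewrite doubleS -[q'.*2.+2%:R]natr1.
  by have := ler0n R q'.*2.+1; move: l_gt; lra.
have h2 : l + q%:R != 0.
  case: (q) q0 => [|q'] q0'; first by rewrite addr0.
  by apply: lt0r_neq0; rewrite -[q'.+1%:R]natr1; have := ler0n R q'; move: l_gt; lra.
move: h1; rewrite -mul2n natrM => h1.
rewrite -![in LHS]natr1 natrM -[q.+1%:R]natr1.
field.
by repeat (apply/andP; split); first [by apply: lt0r_neq0; lra
  | by rewrite addrC | by apply: lt0r_neq0; move: l_gt; lra].
Qed.

Lemma rising_binomial_l_neq0 k : g k != 0.
Proof.
apply: rising_binomial_neq0 => -[|i]; first by rewrite addr0.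
by apply: lt0r_neq0; rewrite -[i.+1%:R]natr1; have := ler0n R i; move: l_gt; lra.
Qed.

Lemma geg_v_even0 q :
  geg_v l (2 * q) 0 = (-1) ^+ q * (e (2 * q) * g q / g (2 * q)).
Proof.
rewrite /geg_v; apply: (mulfI (rising_binomial_l_neq0 (2 * q))).
rewrite mulrCA (_ : g (2 * q) * (geg_u l (2 * q)).[0] = (-1) ^+ q * g q).
  by field; exact: rising_binomial_l_neq0.
by rewrite mul2n geg_c_even0.
Qed.

(** The [n]-th term of [S_(2p)(0)] stripped of its factor [(-1)^(p+n)]. *)
Definition geg_t (p n : nat) : R :=
  g n * g (2 * p + n) * (e (2 * (p + n)) * g (p + n) / g (2 * (p + n))).

Definition geg_ratio (p n : nat) : R :=
  ((l + (2 * (p + n)).+2%:R) * (2 * (p + n)).+1%:R) /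
    ((l + (2 * (p + n))%:R) * (2 * l + (2 * (p + n)).+1%:R))
  * ((l + n%:R) * (l + (2 * p + n)%:R) / (n.+1%:R * (2 * p + n).+1%:R)).

Lemma geg_tS p n : (0 < n)%N -> geg_t p n.+1 = geg_ratio p n * geg_t p n.
Proof.
move=> n0.
rewrite /geg_t /geg_ratio !addnS (_ : (2 * (p + n).+1)%N = (2 * (p + n)).+2); last first.
  by rewrite mulnS.
have h := rising_binomial_l_neq0 (2 * (p + n)).
rewrite !(geg_eS l_gt l_neq0) !rising_binomialS.
have n1 : 1 <= n%:R :> R by rewrite ler1n.
have p0 := ler0n R p.
rewrite mulnDr in h *; field; rewrite h /=; move: l_gt => ?.
by repeat (apply/andP; split); apply: lt0r_neq0; lra.
Qed.

(* With d = 1 - l and Q = p + n + 1 the inequality reduces to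
   2 Q^2 - 1 - 2 d Q + d >= 0. *)
Lemma geg_ratio_bounds p n : (0 < n)%N -> 0 <= geg_ratio p n <= 1.
Proof.
move=> n0; have n1 : 1 <= n%:R :> R by rewrite ler1n.
have p0 := ler0n R p.
rewrite /geg_ratio.
have e2 : (2 * (p + n))%:R = 2 * p%:R + 2 * n%:R :> R by rewrite natrM natrD; ring.
have e3 : (2 * p + n)%:R = 2 * p%:R + n%:R :> R by rewrite natrD natrM.
rewrite -![_.+2%:R]natr1 -![_.+1%:R]natr1 e2 e3 -natr1 {n0 e2 e3}.
move: (p%:R) (n%:R) p0 n1 => P N p0 n1.
move: l_gt l_lt1 => l1 l2.
apply/andP; split.
  by rewrite mulr_ge0 ?divr_ge0 ?mulr_ge0; lra.
rewrite mulf_div ler_pdivrMr ?mul1r; last first.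
  by rewrite !mulr_gt0//; lra.
pose d := 1 - l; pose Q := P + N + 1.
pose A := (2 * Q + 1 - d) * (2 * Q - 1); pose B := (2 * Q - 1 - d) * (2 * Q + 1 - 2 * d).
pose X := (Q - d) ^+ 2 - P ^+ 2; pose Y := Q ^+ 2 - P ^+ 2.
rewrite (_ : _ * _ = A * X); last by rewrite /A /X /Q /d; ring.
rewrite [leRHS](_ : _ = B * Y); last by rewrite /B /Y /Q /d; ring.
have Q2 : 2 <= Q by rewrite /Q; lra.
have d0 : 0 < d by rewrite /d; lra.
have d1 : d < 3 / 2 by rewrite /d; lra.
have Y0 : 0 <= Y.
  have -> : Y = (N + 1) * (2 * P + N + 1) by rewrite /Y /Q; ring.
  by rewrite mulr_ge0//; lra.
have A0 : 0 <= A by rewrite /A mulr_ge0//; lra.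
(* The comparison goes through [X / Y <= (Q - d)^2 / Q^2 <= B / A]; the first inequality is an
   equality at [P = 0]. *)
have XY : X * Q ^+ 2 <= Y * (Q - d) ^+ 2.
  rewrite -subr_ge0 (_ : _ - _ = P ^+ 2 * (d * (2 * Q - d))); last by rewrite /X /Y; ring.
  by rewrite mulr_ge0 ?sqr_ge0// mulr_ge0//; lra.
have AB : A * (Q - d) ^+ 2 <= B * Q ^+ 2.
  rewrite -subr_ge0 (_ : _ - _ = d * (2 * Q - d) * (2 * Q ^+ 2 - 1 - 2 * d * Q + d)).
    rewrite !mulr_ge0//; [lra|lra|nra].
  by rewrite /A /B; ring.
have Q20 : 0 < Q ^+ 2 by rewrite exprn_gt0//; lra.
rewrite -(ler_pM2r Q20) -mulrA.
apply: le_trans (ler_wpM2l A0 XY) _.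
have := ler_wpM2l Y0 AB; lra.
Qed.

Lemma geg_sum_even0 p N : S (2 * p) N 0 =
  (-1) ^+ p * \sum_(0 <= k < N) (-1) ^+ k * geg_t p k.
Proof.
rewrite /geg_sum mulr_sumr; apply: eq_bigr => k _.
by rewrite -mulnDr geg_v_even0 exprD /geg_t; ring.
Qed.

Lemma rising_binomial_ratio_cvg j : g (k + j) / g k @[k --> \oo] --> (1 : R).
Proof.
elim: j => [|j ih].
  by under eq_fun do rewrite addn0 divff ?rising_binomial_l_neq0//; exact: cvg_cst.
have H : (l + n%:R) / n.+1%:R @[n --> \oo] --> (1 : R).
  have h : 1 - (1 - l) * n.+1%:R^-1 @[n --> \oo] --> 1 - (1 - l) * 0.
    by apply: cvgB; [exact: cvg_cst|apply: cvgMr; exact: cvg_harmonic].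
  rewrite mulr0 subr0 in h.
  rewrite (_ : (fun n => _) = (fun n => 1 - (1 - l) * n.+1%:R^-1))//.
  apply/funext => n; rewrite -natr1; field.
  by rewrite natr1 pnatr_eq0.
have H2 := cvg_comp _ _ (cvg_addnl j) H.
have H3 : g (k + j) / g k * ((fun n => (l + n%:R) / n.+1%:R) \o addn j) k
   @[k --> \oo] --> 1 * (1 : R) by exact: cvgM.
rewrite mulr1 in H3.
rewrite (_ : (fun k => _) = (fun k => g (k + j) / g k * ((fun n => (l + n%:R) / n.+1%:R) \o addn j) k))//.
by apply/funext => k; rewrite /= addnS rising_binomialS (addnC j) mulrAC.
Qed.

(** The quotient [g (2p+n) / g (2(p+n))] tends to 1, and [e (2(p+n)) * g (p+n)] tends to [geg_W]. *)
Lemma geg_t_cvg n : geg_t p n @[p --> \oo] --> g n * geg_W l.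
Proof.
have c1 : (fun p => p + n)%N @ \oo --> \oo.
  by rewrite (_ : (fun p => _) = addn n); [exact: cvg_addnl|apply/funext => p; rewrite addnC].
have c2 : (fun p => 2 * p + n)%N @ \oo --> \oo.
  have := cvg_comp _ _ cvg_muln2 c1; apply: cvg_trans.
  by apply: near_eq_cvg; near=> p; rewrite /= mul2n addnn.
have W := cvg_comp _ _ c1 (geg_e_double_cvg l_gt l_lt1 l_neq0).
have Q := cvg_comp _ _ c2 (rising_binomial_ratio_cvg n).
have H : g n * ((((fun k => g (k + n) / g k) \o (fun p => 2 * p + n)%N) p)^-1 *
   ((fun p => e (p + p) * g p) \o (fun p => p + n)%N) p) @[p --> \oo] -->
   g n * (1^-1 * geg_W l).
  by apply: cvgMr; apply: cvgM => //; apply: cvgV => //; exact: oner_neq0.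
rewrite invr1 mul1r in H; apply: cvg_trans H; apply: near_eq_cvg; near=> p.
rewrite /geg_t /= -addnA addnn -mul2n -mulnDr addnn -mul2n.
have h1 := rising_binomial_l_neq0 (2 * (p + n)).
have h2 := rising_binomial_l_neq0 (2 * p + n).
by field; rewrite h1 h2.
Unshelve. all: by end_near. Qed.

Lemma geg_sum_even0_cvg p :
  (-1) ^+ p * S (2 * p) N 0 - S 0 N 0 @[N --> \oo] --> (0 : R).
Proof.
elim: p => [|p ih].
  by under eq_fun do rewrite muln0 expr0 mul1r subrr; exact: cvg_cst.
have r0 : 0 <= (0 : R) < 1 by rewrite lexx ltr01.
have z0 : `|0 : R| <= 0 by rewrite normr0.
have H := unif0_cvg z0 (geg_sum_rec_unif0 l_gt l_lt1 l_neq0 (2 * p) r0).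
have H1 : ((-1) ^+ p * S (2 * p) N 0 - S 0 N 0) - (-1) ^+ p *
  (S (2 * p).+2 N 0 + S (2 * p) N 0 - 2 * 0 * S (2 * p).+1 N 0) @[N --> \oo] --> 0 - (-1) ^+ p * (0 : R).
  by apply: cvgB => //; apply: cvgMr.
have E0 : 0 - (-1) ^+ p * 0 = 0 :> R by rewrite mulr0 subr0.
rewrite E0 in H1; rewrite (_ : (fun N => _) = (fun N => ((-1) ^+ p * S (2 * p) N 0 - S 0 N 0) - (-1) ^+ p *
  (S (2 * p).+2 N 0 + S (2 * p) N 0 - 2 * 0 * S (2 * p).+1 N 0)))//.
by apply/funext => N; rewrite mulnS exprS; ring.
Qed.

(** An Abel limit: at [x = 0] the generating function is [(1 + z^2)^(-l)], and for [z < 1] the tail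
    of its alternating series is at most [|g n0|] independently of [z]; then let [z] tend to 1. The
    ratio at index 0 is [l], possibly negative, hence [0 < n0]. *)
Lemma alternating_rising_binomial n0 : (0 < n0)%N ->
  `|(2 `^ l)^-1 - \sum_(0 <= k < n0) (-1) ^+ k * g k| <= `|g n0|.
Proof.
move=> n00.
pose A (z : R) := \sum_(0 <= k < n0) (-1) ^+ k * (g k * (z ^+ 2) ^+ k).
have ineq (z : R) : 0 <= z < 1 -> `|((1 + z ^+ 2) `^ l)^-1 - A z| <= `|g n0|.
  move=> /andP[z0 z1].
  have gf : pseries (fun n => (geg_c l n).[0]) z @ \oo --> ((1 + z ^+ 2) `^ l)^-1.
    have := @geg_generating_function R l l_gt l_lt1 l_neq0 0 z.
    rewrite mulr0 mul0r subr0; apply; first by rewrite lerN10 ler01.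
    by rewrite ger0_norm.
  have gf2 := cvg_comp _ _ cvg_muln2 gf.
  have E M : pseries (fun n => (geg_c l n).[0]) z (M + M)%N =
      \sum_(0 <= k < M) (-1) ^+ k * (g k * (z ^+ 2) ^+ k).
    rewrite /pseries /series/=; elim: M => [|M ih]; first by rewrite !big_geq.
    rewrite addnS addSn !big_nat_recr//= ih !horner_geg_c addnn geg_u_odd0.
    rewrite geg_c_even0 mulr0 mul0r addr0. by congr (_ + _); rewrite -exprM mul2n [RHS]mulrA.
  have H : `|(pseries (fun n => (geg_c l n).[0]) z \o (fun p => p + p)%N) M - A z|
     @[M --> \oo] --> `|((1 + z ^+ 2) `^ l)^-1 - A z|.
    by apply: cvg_norm; apply: cvgB => //; exact: cvg_cst.
  apply: (cvgr_to_le H); near=> M.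
  rewrite /= E; apply: le_trans (_ : `|g n0 * (z ^+ 2) ^+ n0| <= _); last first.
    rewrite normrM ler_piMr// normrX ger0_norm ?sqr_ge0// exprn_ile1 ?sqr_ge0//.
    by rewrite expr_le1//; lra.
  apply: (@alternating_tail_le (fun k => g k * (z ^+ 2) ^+ k)
    (fun k => (l + k%:R) / k.+1%:R * z ^+ 2)).
  - by move=> n _; rewrite rising_binomialS exprS; ring.
  - move=> n n0n; have n1 : 1 <= n%:R :> R by rewrite ler1n (leq_trans n00).
    have z2 : 0 <= z ^+ 2 <= 1 by rewrite sqr_ge0 expr_le1//; lra.
    have lk : 0 <= (l + n%:R) / n.+1%:R <= 1.
      rewrite ler_pdivrMr// mul1r divr_ge0//=; first by rewrite -natr1; move: l_lt1; lra.
      by move: l_gt; lra.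
    by case/andP: z2 => ? ?; case/andP: lk => ? ?; rewrite mulr_ge0//= mulr_ile1.
  - by near: M; exact: nbhs_infty_ge.
pose zn (k : nat) : R := 1 - k.+1%:R^-1.
have zc : zn @ \oo --> (1 : R).
  have h : zn @ \oo --> 1 - (0 : R).
    by apply: cvgB; [exact: cvg_cst|exact: cvg_harmonic].
  by rewrite subr0 in h.
have z2c : zn k ^+ 2 @[k --> \oo] --> (1 : R).
  have h := cvg_comp _ _ zc (@exprn_continuous R 2 1).
  by rewrite expr1n in h.
have z3c : 1 + zn k ^+ 2 @[k --> \oo] --> (2 : R).
  by rewrite (_ : (2 : R) = 1 + 1)//; apply: cvgD => //; exact: cvg_cst.
have pc : (1 + zn k ^+ 2) `^ l @[k --> \oo] --> 2 `^ l.
  have cp : {for (2 : R), continuous (fun x : R => x `^ l)}.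
    apply/differentiable_continuous/derivable1_diffP.
    by apply: derivable_powR; rewrite in_itv/= ltr0n.
  exact: (cvg_comp _ _ z3c cp).
have Ac : A (zn k) @[k --> \oo] --> \sum_(0 <= k < n0) (-1) ^+ k * g k.
  rewrite /A; clear A ineq n00; elim: n0 => [|n ih].
    by under eq_fun do rewrite big_geq//; rewrite big_geq//; exact: cvg_cst.
  under eq_fun do rewrite big_nat_recr//=.
  rewrite big_nat_recr//=; apply: cvgD => //; apply: cvgMr.
  have h : g n * (zn k ^+ 2) ^+ n @[k --> \oo] --> g n * 1 ^+ n.
    by apply: cvgMr; exact: (cvg_comp _ _ z2c (@exprn_continuous R n 1)).
  by rewrite expr1n mulr1 in h.
have H : `|((1 + zn k ^+ 2) `^ l)^-1 - A (zn k)| @[k --> \oo] -->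
    `|(2 `^ l)^-1 - \sum_(0 <= k < n0) (-1) ^+ k * g k|.
  by apply: cvg_norm; apply: cvgB => //; apply: cvgV => //; rewrite lt0r_neq0// powR_gt0.
apply: (cvgr_to_le H); near=> k; apply: ineq.
have k0 : 0 < k.+1%:R^-1 :> R by rewrite invr_gt0.
have k1 : k.+1%:R^-1 <= 1 :> R by rewrite invf_le1// ler1n.
rewrite /zn; move: (k.+1%:R^-1) k0 k1 => y y0 y1.
by apply/andP; split; lra.
Unshelve. all: by end_near. Qed.

Definition geg_sigma : R := geg_W l * (2 `^ l)^-1.

(* Up to a tail of size at most |geg_t p n0|, the sum S_0(0) = (-1)^p S_(2p)(0) is
   the n0-th partial sum, whose terms tend to g_n geg_W as p -> oo. *)
Lemma geg_sum0_cvg : S 0 N 0 @[N --> \oo] --> geg_sigma.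
Proof.
apply/cvgrPdist_le => eps eps0.
pose w := `|geg_W l| + 1; have w0 : 0 < w by rewrite ltr_wpDl.
(* The final estimate adds two errors of size [d * w] and three of size [d]. The order of choice is
   essential: [n0] from [d], then [p] from [n0], then [N]. *)
pose d := eps / (w + w + 1 + 1 + 1).
have d0 : 0 < d by apply: divr_gt0 => //; lra.
have [n0 [n00 gn0]] : exists n0, (0 < n0)%N /\ `|g n0| <= d.
  have := rising_binomial_cvg0 l_gt l_lt1 l_neq0.
  move/cvgr0Pnorm_le => /(_ d d0) [N _ H]; exists N.+1; split=> //.
  by apply: H => /=; exact: leqnSn.
pose A := \sum_(0 <= k < n0) (-1) ^+ k * g k.
pose T p N := \sum_(0 <= k < N) (-1) ^+ k * geg_t p k.
have hA : `|(2 `^ l)^-1 - A| <= d.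
  by apply: le_trans (alternating_rising_binomial n00) gn0.
have Tc : T p n0 @[p --> \oo] --> A * geg_W l.
  rewrite /T /A; elim: {+}n0 => [|n ih].
    by under eq_fun do rewrite big_geq//; rewrite big_geq// mul0r; exact: cvg_cst.
  under eq_fun do rewrite big_nat_recr//=.
  rewrite big_nat_recr//= mulrDl; apply: cvgD => //.
  by rewrite -mulrA; apply: cvgMr; exact: geg_t_cvg.
have [p [hp1 hp2]] : exists p, `|A * geg_W l - T p n0| <= d /\ `|g n0 * geg_W l - geg_t p n0| <= d.
  have H1 : \forall p \near \oo, `|A * geg_W l - T p n0| <= d.
    by move/cvgrPdist_le : Tc; exact.
  have H2 : \forall p \near \oo, `|g n0 * geg_W l - geg_t p n0| <= d.
    by move/cvgrPdist_le : (@geg_t_cvg n0); exact.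
  have [P _ H] := filterI H1 H2; exists P; split; by have [] := H P (leqnn P).
have HN : \forall N \near \oo, `|(-1) ^+ p * S (2 * p) N 0 - S 0 N 0| <= d.
  by move/cvgr0Pnorm_le : (geg_sum_even0_cvg p); exact.
near=> N.
have hN : `|(-1) ^+ p * S (2 * p) N 0 - S 0 N 0| <= d by near: N.
have n0N : (n0 <= N)%N by near: N; exact: nbhs_infty_ge.
have sg : (-1) ^+ p * S (2 * p) N 0 = T p N.
  by rewrite geg_sum_even0 mulrA -exprD addnn -mul2n exprM sqrrN !expr1n mul1r.
rewrite sg in hN.
have tail : `|T p N - T p n0| <= `|geg_t p n0|.
  apply: (@alternating_tail_le _ (geg_ratio p)) => // n n0n.
    by apply: geg_tS; exact: leq_trans n0n.
  by apply: geg_ratio_bounds; exact: leq_trans n0n.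
have tn0 : `|geg_t p n0| <= d * w + d.
  have -> : geg_t p n0 = g n0 * geg_W l - (g n0 * geg_W l - geg_t p n0) by ring.
  apply: le_trans (ler_normB _ _) _; apply: lerD => //.
  by rewrite normrM ler_pM// /w lerDl.
have -> : geg_sigma - S 0 N 0 = ((2 `^ l)^-1 - A) * geg_W l + (A * geg_W l - T p n0)
   - (T p N - T p n0) + (T p N - S 0 N 0) by rewrite /geg_sigma; ring.
have hAW : `|((2 `^ l)^-1 - A) * geg_W l| <= d * w.
  by rewrite normrM ler_pM// /w lerDl.
have -> : eps = d * w + d + (d * w + d) + d.
  by rewrite /d; field; apply: lt0r_neq0; lra.
apply: le_trans (ler_normD _ _) _; apply: lerD => //.
apply: le_trans (ler_normB _ _) _; apply: lerD; last exact: le_trans tail tn0.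
by apply: le_trans (ler_normD _ _) _; apply: lerD.
Unshelve. all: by end_near. Qed.

End value_at_0.

(** * Uniform limit *)

Section uniform_limit.
Context {R : realType} (l : R).
Hypotheses (l_gt : - 2^-1 < l) (l_lt1 : l < 1) (l_neq0 : l != 0).

Local Notation S := (geg_sum l).
Local Notation T := (chebyshevT R).

Lemma geg_sum_unif0 (r : R) m : 0 <= r < 1 -> unif0 r (fun N x =>
  S m N.+1 x - geg_sigma l * ((T m).[x] / (1 - x ^+ 2) `^ l)).
Proof.
move=> r01; have /andP[r0 r1] := r01.
pose q (x : R) := ((1 - x ^+ 2) `^ l)^-1.
pose D m N x := S m N.+1 x - geg_sigma l * ((T m).[x] * q x).
have xr1 (x : R) : `|x| <= r -> `|x| <= 1 by move=> /le_trans; apply; exact: ltW.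
have x11 (x : R) : `|x| <= r -> -1 <= x <= 1 by move=> /xr1; rewrite ler_norml.
pose y0 := 1 - r ^+ 2; have y00 : 0 < y0 by rewrite /y0; nra.
have y0x (x : R) : `|x| <= r -> y0 <= 1 - x ^+ 2 /\ 1 - x ^+ 2 <= 1.
  move=> xr; rewrite lerD2l lerN2 -[x ^+ 2]real_normK ?num_real//; split.
    by rewrite lerXn2r ?nnegrE.
  by rewrite gerBl sqr_ge0.
have qK (x : R) : `|x| <= r -> `|q x| <= y0 `^ (- `|- l|).
  move=> xr; have [yx xy] := y0x x xr.
  by rewrite /q -powRN ger0_norm ?powR_ge0//; exact: powR_le_normN.
have qp (x : R) : `|x| <= r -> (1 - x ^+ 2) `^ l != 0.
  by move=> /y0x[/(lt_le_trans y00) h _]; rewrite lt0r_neq0// powR_gt0.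
have D0 : unif0 r (D 0%N).
  have cv : unif0 r (fun N (_ : R) => S 0 N.+1 0 - geg_sigma l).
    apply: cvg_unif0; have H := geg_sum0_cvg l_gt l_lt1 l_neq0.
    have H1 : S 0 N.+1 0 @[N --> \oo] --> geg_sigma l.
      by rewrite (cvg_shiftS (fun N => S 0 N 0)).
    have H2 : S 0 N.+1 0 - geg_sigma l @[N --> \oo] --> geg_sigma l - geg_sigma l.
      by apply: cvgB => //; exact: cvg_cst.
    by rewrite subrr in H2.
  apply: eq_unif0 (unif0M qK (unif0D (geg_sum0_unif0 l_gt l_lt1 l_neq0 r01) cv)).
  move=> N x xr; rewrite /D horner_chebyshevT0 ?x11// /q.
  by move: (qp x xr) => h; field.
have D1 : unif0 r (D 1%N).
  apply: eq_unif0 (unif0D (@unif0M _ r `|2^-1| (fun=> 2^-1) _ (fun _ _ => lexx _)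
    (geg_sum1_unif0 l_gt l_lt1 l_neq0 r01)) (@unif0M _ _ 1 id _ xr1 D0)).
  move=> N x xr; rewrite /D horner_chebyshevT0 ?x11// horner_chebyshevT1 ?x11//.
  by field.
suff [] : unif0 r (D m) /\ unif0 r (D m.+1) by [].
elim: m => [//|m [Dm Dm1]]; split=> //.
have x2 (x : R) : `|x| <= r -> `|2 * x| <= 2.
  by move=> /xr1 h; rewrite normrM ger0_norm// ler_piMr.
have H := unif0_shift (geg_sum_rec_unif0 l_gt l_lt1 l_neq0 m r01).
apply: eq_unif0 (unif0D (unif0D H (unif0M x2 Dm1)) (unif0N Dm)) => N x xr.
by rewrite /D horner_chebyshevTSS ?x11//; ring.
Qed.

Lemma geg_sigmaE :
  Num.sqrt pi * Gamma l / Gamma (l + 2^-1) * geg_sigma l = 1.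
Proof.
have G1 : Gamma l != 0.
  have [l0|l0|/eqP] := ltgtP l 0; last by rewrite (negPf l_neq0).
    rewrite GammaE_lt0; last by move: l_gt; lra.
    by rewrite mulf_neq0 ?invr_neq0// lt0r_neq0// Euler_integral_gt0//; move: l_gt; lra.
  by rewrite GammaE_gt0// lt0r_neq0// Euler_integral_gt0.
have G2 : Gamma (l + 2^-1) != 0.
  have h : 0 < l + 2^-1 by move: l_gt; lra.
  by rewrite GammaE_gt0// lt0r_neq0// Euler_integral_gt0.
have P : Num.sqrt pi != 0 :> R by rewrite lt0r_neq0// sqrtr_gt0 pi_gt0.
have T2 : 2 `^ l != 0 :> R by rewrite lt0r_neq0// powR_gt0.
rewrite /geg_sigma /geg_W.
by field; rewrite G1 G2 P T2.
Qed.

End uniform_limit.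

Lemma compact_sub_itv_oo (R : realType) (K : set R) :
  compact K -> K `<=` `]-1, 1[ ->
  exists2 r : R, 0 <= r < 1 & forall x, K x -> `|x| <= r.
Proof.
move=> cK K1; have [->|K0] := eqVneq K set0.
  by exists 0 => //; rewrite lexx ltr01.
have nc : {within K, continuous (fun x : R => `|x|)}.
  apply: continuous_subspaceT => x; exact: norm_continuous.
move/set0P : K0 => K0; have [c] := compact_EVT_max K0 cK nc.
rewrite inE => Kc cmax; exists `|c|.
  have := K1 c Kc; rewrite /= in_itv/= => /andP[c1 c2].
  by rewrite normr_ge0 ltr_norml c1 c2.
by move=> x Kx; apply: cmax; rewrite inE.
Qed.

Lemma unif0_uniform (R : realType) (K : set R) (r : R) (F : nat -> R -> R) (f : R -> R) :
  (forall x, K x -> `|x| <= r) -> unif0 r (fun N x => F N x - f x) ->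
  {uniform K, F @ \oo --> f}.
Proof.
move=> Kr Ff P /uniform_nbhs[E [entE subP]].
move: entE; rewrite -entourage_ballE => -[e/= e0 sub].
have e20 : 0 < e / 2 by rewrite divr_gt0.
apply: filterS (Ff _ e20) => N HN; apply: subP => y Ky; apply: sub.
rewrite /ball/= distrC; apply: le_lt_trans (HN y (Kr y Ky)) _.
by rewrite ltr_pdivrMr// mulr_natr mulr2n ltrDl.
Qed.

Theorem theorem4 (R : realType) (m : nat) (lambda : R)
    (lambda_bounds : - 2^-1 < lambda < 1) (lambda_neq0 : lambda != 0) :
  let term (x : R) (n : nat) : R :=
    (lambda + m%:R + 2 * n%:R)
    * (rising_binomial lambda n * rising_binomial lambda (m + n)
       / rising_binomial (2 * lambda) (m + 2 * n))
    * (gegenbauer lambda (m + 2 * n)).[x] in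
  (forall x : R, -1 < x < 1 ->
     cvgn (series (term x)) /\
     (chebyshevT R m).[x] / (1 - x ^+ 2) `^ lambda =
       Num.sqrt pi * Gamma lambda / Gamma (lambda + 2^-1)
       * limn (series (term x))) /\
  (forall K : set R, compact K -> K `<=` `]-1, 1[ ->
     {uniform K, (fun (N : nat) (x : R) => series (term x) N) @ \oo -->
        (fun x : R => limn (series (term x)))}).
Proof.
have /andP[l_gt l_lt1] := lambda_bounds; move=> term.
have termE x N : -1 <= x <= 1 -> series (term x) N = geg_sum lambda m N x.
  move=> x1; apply: eq_bigr => n _.
  rewrite /term gegenbauerE// horner_geg_c /geg_v /geg_e natrD natrM; ring.
pose L (x : R) := geg_sigma lambda * ((chebyshevT R m).[x] / (1 - x ^+ 2) `^ lambda).
have unif r : 0 <= r < 1 -> unif0 r (fun N x => series (term x) N - L x).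
  move=> r01; have /andP[r0 r1] := r01 => e e0.
  have [N _ H] := geg_sum_unif0 l_gt l_lt1 lambda_neq0 m r01 e0.
  (* [geg_sum_unif0] concerns sums of [N.+1] terms, hence the shift. *)
  exists N.+1 => // -[//|k] /= Nk x xr; rewrite termE; first exact: H.
  by rewrite -ler_norml (le_trans xr)// ltW.
have cv x : -1 < x < 1 -> series (term x) @ \oo --> L x.
  move=> x1; have r01 : 0 <= `|x| < 1 by rewrite normr_ge0 ltr_norml.
  have H := unif0_cvg (lexx `|x|) (unif _ r01).
  have H1 : series (term x) N - L x + L x @[N --> \oo] --> 0 + L x.
    by apply: cvgD => //; exact: cvg_cst.
  rewrite add0r in H1; move: H1.
  by under eq_fun do rewrite subrK.
have lim x : -1 < x < 1 -> limn (series (term x)) = L x.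
  by move=> x1; apply/cvg_lim => //; exact: cv.
split=> [x x1|K cK K1].
  split; first by apply/cvg_ex; exists (L x); exact: cv.
  by rewrite lim// /L mulrA geg_sigmaE// mul1r.
have [r r01 Kr] := compact_sub_itv_oo cK K1; have /andP[_ r1] := r01.
apply: (unif0_uniform Kr); apply: eq_unif0 (unif r r01) => N x xr.
by rewrite lim// -ltr_norml (le_lt_trans xr).
Qed.
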